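(* Every self-modulus Turing degree $\mathbf d$ with $\mathbf d\ge\mathbf 0'$ contains a weakly $1$-generic NCR real.
   Context: A Turing degree is a self-modulus degree if it contains a real $A$ with a self-modulus, i.e. a function $f_A\equiv_T A$ such that every function dominating $f_A$ (exceeding it at all but finitely many arguments) computes $A$. A real $X$ is weakly $1$-generic if for every $\Sigma^0_1$ set $W$ of finite binary strings that is dense (every string has an extension in $W$), some initial segment of $X$ lies in $W$. A representation of a probability measure $\mu$ on $2^{\mathbb N}$ is a real coding a fast-converging sequence of indices of measures from a fixed effectively enumerated countable dense subset of the space of probability measures. For a representation $R$ of $\mu$, $Y$ is $R$-$\mu$-random if $Y\notin\bigcap_nV_n$ for all uniformly $\Sigma^0_1(R)$ sequences $(V_n)$ with $\mu(V_n)\le2^{-n}$. Continuous: all singletons have measure $0$. A real is NCR if it is not $R$-$\mu$-random for any continuous probability measure $\mu$ and representation $R$ of $\mu$. *)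

(* Defs.v *)
From HB Require Import structures.
From mathcomp Require Import all_boot all_order all_algebra.
From mathcomp Require Import all_classical all_reals all_analysis.
From Stdlib Require Cantor.

Set Implicit Arguments.
Unset Strict Implicit.
Unset Printing Implicit Defensive.

Import Order.TTheory GRing.Theory Num.Theory.
Local Open Scope classical_set_scope.

Definition npair (m n : nat) : nat := Cantor.to_nat (m, n).
Definition nfst (z : nat) : nat := fst (Cantor.of_nat z).
Definition nsnd (z : nat) : nat := snd (Cantor.of_nat z).

(** Partial recursive functions relative to an oracle [g : nat -> nat]; all
    functions are unary, several arguments being passed through the (primitive
    recursive) Cantor pairing. *)

Inductive program : Type :=
  | Zero | Succ | Fst | Snd | Oracle
  | Pair of program & program
  | Comp of program & program
  | Prec of program & program
  | Mu of program.

(** [computes g p x y]: on input [x] with oracle [g], program [p] halts with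
    output [y]. *)
Inductive computes (g : nat -> nat) : program -> nat -> nat -> Prop :=
  | ev_zero x : computes g Zero x 0
  | ev_succ x : computes g Succ x x.+1
  | ev_fst x : computes g Fst x (nfst x)
  | ev_snd x : computes g Snd x (nsnd x)
  | ev_oracle x : computes g Oracle x (g x)
  | ev_pair p q x y z : computes g p x y -> computes g q x z ->
      computes g (Pair p q) x (npair y z)
  | ev_comp p q x y z : computes g q x y -> computes g p y z ->
      computes g (Comp p q) x z
  | ev_prec0 p q a y : computes g p a y ->
      computes g (Prec p q) (npair a 0) y
  | ev_precS p q a n y z : computes g (Prec p q) (npair a n) y ->
      computes g q (npair a (npair n y)) z ->
      computes g (Prec p q) (npair a n.+1) z
  | ev_mu p a n : computes g p (npair a n) 0 ->
      (forall m, m < n -> exists k, computes g p (npair a m) k.+1) ->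
      computes g (Mu p) a n.

Definition turing_le (f g : nat -> nat) : Prop :=
  exists p, forall n, computes g p n (f n).

Definition turing_eq (f g : nat -> nat) : Prop :=
  turing_le f g /\ turing_le g f.

(** The reals of the theory are the elements of [cantor_space]. *)
Definition real_fun (X : cantor_space) : nat -> nat := fun n => nat_of_bool (X n).

Fixpoint goedel (p : program) : nat :=
  match p with
  | Zero => npair 0 0
  | Succ => npair 1 0
  | Fst => npair 2 0
  | Snd => npair 3 0
  | Oracle => npair 4 0
  | Pair p q => npair 5 (npair (goedel p) (goedel q))
  | Comp p q => npair 6 (npair (goedel p) (goedel q))
  | Prec p q => npair 7 (npair (goedel p) (goedel q))
  | Mu p => npair 8 (goedel p)
  end.

(** [{<e, x> | the program with number e halts on input x}]; the constant zero
    oracle amounts to having no oracle. *)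
Definition halting_set : cantor_space := fun z =>
  `[< exists p x y, z = npair (goedel p) x /\ computes (cst 0) p x y >].

Record turing_degree : Type := TuringDegree {
  degree_set : set cantor_space;
  degree_setP : exists A : cantor_space,
    degree_set = [set B | turing_eq (real_fun B) (real_fun A)] }.

Definition degree_of (A : cantor_space) : turing_degree :=
  @TuringDegree [set B | turing_eq (real_fun B) (real_fun A)]
    (ex_intro _ A erefl).

Definition degree_le (c d : turing_degree) : Prop :=
  forall A B : cantor_space, degree_set c A -> degree_set d B -> turing_le (real_fun A) (real_fun B).

Definition zero_jump : turing_degree := degree_of halting_set.

Definition dominates (g f : nat -> nat) : Prop :=
  exists n0, forall n, n0 <= n -> f n < g n.

Definition self_modulus (A : cantor_space) (f : nat -> nat) : Prop :=
  turing_eq f (real_fun A) /\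
  forall g : nat -> nat, dominates g f -> turing_le (real_fun A) g.

Definition self_modulus_degree (d : turing_degree) : Prop :=
  exists2 A : cantor_space, degree_set d A & exists f, self_modulus A f.

(** [S] is the projection of a relation decidable with oracle [g]. *)
Definition sigma01 (g : nat -> nat) (S : set nat) : Prop :=
  exists P : nat -> bool, turing_le (fun z => nat_of_bool (P z)) g /\
    S = [set x | exists y, P (npair x y)].

(** Bijective base-2 numbering of the binary strings. *)
Definition str_code (s : seq bool) : nat :=
  foldr (fun (b : bool) n => (n.*2 + b).+1) 0 s.

Definition prefix_of (X : cantor_space) (n : nat) : seq bool := mkseq X n.

Definition dense_strings (W : set (seq bool)) : Prop :=
  forall s, exists2 t, prefix s t & W t.

Definition weakly_1_generic (X : cantor_space) : Prop :=
  forall W : set (seq bool), sigma01 (cst 0) (str_code @` W) ->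
    dense_strings W -> exists n, W (prefix_of X n).

Definition borel_cantor := g_sigma_algebraType (@open cantor_space).

Definition cylinder (s : seq bool) : set cantor_space :=
  [set X | prefix_of X (size s) = s].

Local Open Scope ring_scope.
Local Open Scope ereal_scope.

Section AverageDirac.
Variables (R : realType) (s : seq bool) (l : seq (seq bool)).

Definition zero_extend (t : seq bool) : cantor_space := fun n => nth false t n.

(** The average of the Dirac measures at [t 0 0 0 ...] for [t] in the nonempty
    list [s :: l]. Since repetitions are allowed, these are exactly the convex
    combinations with rational coefficients of Dirac measures at eventually
    zero sequences. *)
Definition avg_dirac : set borel_cantor -> \bar R :=
  mscale ((((size l).+1%:R : R)^-1)%:nng)%R
    (msum (fun i => dirac (zero_extend (nth [::] (s :: l) i) : borel_cantor))
       (size l).+1).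

HB.instance Definition _ := Measure.on avg_dirac.

Lemma avg_dirac_setT : avg_dirac setT = 1.
Proof.
transitivity (((size l).+1%:R^-1)%:E * \sum_(i < (size l).+1) (1 : \bar R)).
  by congr (_ * _); apply: eq_bigr => i _; exact: diracT.
by rewrite sumEFin sumr_const card_ord -EFinM mulVf// pnatr_eq0.
Qed.

HB.instance Definition _ :=
  Measure_isProbability.Build _ _ _ avg_dirac avg_dirac_setT.

End AverageDirac.

(** A bijection between the pairs [(s, l)] and [nat]. *)
Definition measure_index (s : seq bool) (l : seq (seq bool)) : nat :=
  npair (str_code s) (foldr (fun t n => (npair (str_code t) n).+1) 0%N l).

(** [d(mu, nu) = sum_n 2^-n (1/2) sum_{|s| = n} |mu[s] - nu[s]|], which
    metrizes weak convergence. *)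
Definition measure_dist (R : realType) (mu nu : probability borel_cantor R) :
    \bar R :=
  \sum_(0 <= n <oo) (2 ^- n.+1)%:E *
    \sum_(s : n.-tuple bool) `| mu (cylinder s) - nu (cylinder s) |.

(** [r] is the graph of a sequence of indices of measures converging fast to
    [mu]. *)
Definition representation (R : realType) (mu : probability borel_cantor R)
    (r : cantor_space) : Prop :=
  exists q : nat -> seq bool * seq (seq bool),
    (forall n m, r (npair n m) = (m == measure_index (q n).1 (q n).2)) /\
    (forall n, measure_dist (avg_dirac R (q n).1 (q n).2) mu <= (2 ^- n)%:E).

Definition uniformly_sigma01 (g : nat -> nat) (V : nat -> set cantor_space) :
    Prop :=
  exists W : nat -> set (seq bool),
    sigma01 g [set z | exists n s, W n s /\ z = npair n (str_code s)] /\
    forall n, V n = \bigcup_(s in W n) cylinder s.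

Definition random_for (R : realType) (mu : probability borel_cantor R)
    (r Y : cantor_space) : Prop :=
  forall V : nat -> set cantor_space, uniformly_sigma01 (real_fun r) V ->
    (forall n, mu (V n) <= (2 ^- n)%:E) -> ~ (\bigcap_n V n) Y.

Definition continuous_measure (R : realType) (mu : probability borel_cantor R) :
    Prop :=
  forall x : cantor_space, mu [set x] = 0.

Definition NCR (R : realType) (X : cantor_space) : Prop :=
  forall (mu : probability borel_cantor R) (r : cantor_space),
    continuous_measure mu -> representation mu r -> ~ random_for mu r X.

(* Main.v *)
Require Import Defs.
From mathcomp Require Import all_boot all_order all_algebra.
From mathcomp Require Import all_classical all_reals all_analysis.
From mathcomp Require Import zify ring lra.
From Stdlib Require Cantor.

Set Implicit Arguments.
Unset Strict Implicit.
Unset Printing Implicit Defensive.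

(* Let [f] be a self-modulus of [A]. The real [X] is the limit of strings
   [s_0, s_1, ...]: step [e] appends [f e] zeros and a marker [1 b], where
   [b = 1] iff the resulting string has an extension in the [e]-th c.e. set; if
   so, it then appends the first such extension found. As [A >= 0'], [X] is
   computable from [A], and it meets every dense c.e. set. The bit [b] tells
   when to search, so [X] computes all the steps, hence [f], hence [A].

   Let [r] represent a continuous measure [mu], and let [g <= r] be such that
   cylinders of length [>= g n] have measure at most [2^-n]. Put
   [c e = g (n + e + 1 + m_e)], where [2^m_e] bounds the number of strings that
   [e] steps can produce when step [i] uses fewer than [c i] zeros. The
   cylinders of these strings followed by [c e] zeros, for all [e], form a test
   of measure at most [2^-n], uniformly c.e. in [r]; it catches [X] unless
   [f e < c e] for all [e]. So if [X] passes all these tests, then some such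
   [c <= r] dominates [f], and [r] computes [A], hence [X]; but then the
   cylinders of the initial segments of [X] of length [g n] form a test that
   catches [X]. *)

(** * Oracle computability *)

Arguments npair : simpl never.
Arguments nfst : simpl never.
Arguments nsnd : simpl never.

Lemma nfstE x y : nfst (npair x y) = x.
Proof. by rewrite /nfst /npair Cantor.cancel_of_to. Qed.

Lemma nsndE x y : nsnd (npair x y) = y.
Proof. by rewrite /nsnd /npair Cantor.cancel_of_to. Qed.

Definition npairE := (nfstE, nsndE).

Lemma npair_eta z : npair (nfst z) (nsnd z) = z.
Proof.
by rewrite /npair /nfst /nsnd -surjective_pairing Cantor.cancel_to_of.
Qed.

Lemma npair_inj x y x' y' : npair x y = npair x' y' -> x = x' /\ y = y'.
Proof. by move=> e; rewrite -(nfstE x y) -{2}(nsndE x y) e !npairE. Qed.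

Lemma leq_npair x y : y <= npair x y.
Proof.
apply/leP; apply: PeanoNat.Nat.le_trans (Cantor.to_nat_non_decreasing x y).
exact: PeanoNat.Nat.le_add_r.
Qed.

Section Inversion.
Variable g : nat -> nat.

Lemma computesP (p : program) x y : computes g p x y <->
  match p with
  | Zero => y = 0
  | Succ => y = x.+1
  | Fst => y = nfst x
  | Snd => y = nsnd x
  | Oracle => y = g x
  | Pair p q => computes g p x (nfst y) /\ computes g q x (nsnd y)
  | Comp p q => exists2 v, computes g q x v & computes g p v y
  | Prec p q =>
      if nsnd x is n.+1 then
        exists2 v, computes g (Prec p q) (npair (nfst x) n) v &
                   computes g q (npair (nfst x) (npair n v)) y
      else computes g p (nfst x) y
  | Mu p => computes g p (npair x y) 0 /\
      forall m, m < y -> exists k, computes g p (npair x m) k.+1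
  end.
Proof.
split.
  by case=> //= *; rewrite ?npairE //; eexists; eauto.
case: p => [|||||p q|p q|p q|p] => [->|->|->|->|->|[]|[v]||[]].
- exact: ev_zero.
- exact: ev_succ.
- exact: ev_fst.
- exact: ev_snd.
- exact: ev_oracle.
- by rewrite -(npair_eta y) !npairE; exact: ev_pair.
- exact: ev_comp.
- rewrite -(npair_eta x) !npairE; case: (nsnd x) => [|n]; first exact: ev_prec0.
  by move=> [v]; exact: ev_precS.
- exact: ev_mu.
Qed.

Lemma computes_fun p x y y' : computes g p x y -> computes g p x y' -> y = y'.
Proof.
elim: p x y y' => [|||||p IHp q IHq|p IHp q IHq|p IHp q IHq|p IHp] x y y';
  try by move=> /computesP-> /computesP->.
- move=> /computesP[/IHp py /IHq qy] /computesP[/py e1 /qy e2].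
  by rewrite -(npair_eta y) -(npair_eta y') e1 e2.
- by move=> /computesP[v /IHq vE /IHp yE] /computesP[w /vE <- /yE].
- rewrite -(npair_eta x); move: (nfst x) (nsnd x) => {}x n.
  elim: n y y' => [|n IHn] y y' /computesP + /computesP; rewrite !npairE.
    exact: IHp.
  by move=> [v /IHn vE /IHq yE] [w /vE <- /yE].
- move=> /computesP[y0 yS] /computesP[y'0 y'S].
  case: (ltngtP y y') => // [/y'S|/yS] [k].
  + by move/(IHp _ _ _ y0).
  + by move/(IHp _ _ _ y'0).
Qed.

End Inversion.

Section OracleSubst.
Variables (g g' : nat -> nat) (r : program).
Hypothesis rP : forall n, computes g' r n (g n).

Fixpoint osubst (p : program) : program :=
  match p with
  | Oracle => r
  | Pair p q => Pair (osubst p) (osubst q)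
  | Comp p q => Comp (osubst p) (osubst q)
  | Prec p q => Prec (osubst p) (osubst q)
  | Mu p => Mu (osubst p)
  | p => p
  end.

Lemma osubstP p x y : computes g p x y -> computes g' (osubst p) x y.
Proof.
elim: p x y => [|||||p IHp q IHq|p IHp q IHq|p IHp q IHq|p IHp] x y
  /computesP; try by move=> ->; exact/computesP.
- by move=> ->; exact: rP.
- by move=> [/IHp ? /IHq ?]; apply/computesP.
- by move=> [v /IHq ? /IHp ?]; apply/computesP; exists v.
- rewrite -(npair_eta x); move: (nfst x) (nsnd x) => {}x n; rewrite !npairE.
  elim: n y => [|n IHn] y; last first.
    move=> [v /computesP]; rewrite !npairE => /IHn ? /IHq ?.
    by apply/computesP; rewrite !npairE; exists v.
  by move=> /IHp ?; apply/computesP; rewrite !npairE.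
- move=> [/IHp y0 yS]; apply/computesP; split=> // m /yS[k /IHp].
  by exists k.
Qed.

End OracleSubst.

Lemma eq_turing_le g f h : f =1 h -> turing_le f g -> turing_le h g.
Proof. by move=> fh [p pP]; exists p => n; rewrite -fh. Qed.

Lemma turing_le_refl g : turing_le g g.
Proof. by exists Oracle => n; exact: ev_oracle. Qed.

Lemma turing_le_trans g f h : turing_le f g -> turing_le g h -> turing_le f h.
Proof.
by move=> [p pP] [r rP]; exists (osubst r p) => n; exact: (osubstP rP).
Qed.

Lemma turing_eq_trans g f h : turing_eq f g -> turing_eq g h -> turing_eq f h.
Proof.
by move=> [? ?] [? ?]; split; [exact: (turing_le_trans (g := g))|
  exact: (turing_le_trans (g := g))].
Qed.

(** * Closure properties of computability relative to a fixed oracle *)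

Section Closure.
Variable g : nat -> nat.
Implicit Types (f h : nat -> nat) (P Q : nat -> bool).

Lemma turing_le_id : turing_le (fun z => z) g.
Proof.
exists (Pair Fst Snd) => n; rewrite computesP; split; exact/computesP.
Qed.

Lemma turing_le_cst c : turing_le (fun=> c) g.
Proof.
elim: c => [|c [p pP]]; first by exists Zero => n; exact: ev_zero.
by exists (Comp Succ p) => n; apply: ev_comp (pP n) _; exact: ev_succ.
Qed.

Lemma turing_le_comp F f : turing_le F g -> turing_le f g ->
  turing_le (fun z => F (f z)) g.
Proof.
by move=> [p pP] [q qP]; exists (Comp p q) => n; exact: ev_comp (qP n) (pP _).
Qed.

Lemma turing_le_pair f h : turing_le f g -> turing_le h g ->
  turing_le (fun z => npair (f z) (h z)) g.
Proof. by move=> [p pP] [q qP]; exists (Pair p q) => n; exact: ev_pair. Qed.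

Lemma turing_le_succ f : turing_le f g -> turing_le (fun z => (f z).+1) g.
Proof.
by apply: turing_le_comp; exists Succ => n; exact: ev_succ.
Qed.

Lemma turing_le_fst f : turing_le f g -> turing_le (fun z => nfst (f z)) g.
Proof. by apply: turing_le_comp; exists Fst => n; exact: ev_fst. Qed.

Lemma turing_le_snd f : turing_le f g -> turing_le (fun z => nsnd (f z)) g.
Proof. by apply: turing_le_comp; exists Snd => n; exact: ev_snd. Qed.

(** [Prec] carries its parameter as the first component of its input, so taking [z] itself as
    parameter lets the base, the step and the number of rounds all depend on it. *)
Lemma turing_le_rec f h (S : nat -> nat -> nat -> nat) :
  turing_le f g ->
  turing_le (fun w => S (nfst w) (nfst (nsnd w)) (nsnd (nsnd w))) g ->
  turing_le h g ->
  turing_le (fun z => nat_rect (fun=> nat) (f z) (S z) (h z)) g.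
Proof.
move=> [p pP] [q qP] hP.
have rP : turing_le (fun w => nat_rect (fun=> nat) (f (nfst w))
    (S (nfst w)) (nsnd w)) g.
  exists (Prec p q) => w; rewrite -{1}(npair_eta w).
  elim: (nsnd w) => [|n IHn]; first exact: ev_prec0.
  by apply: ev_precS IHn _; have := qP (npair (nfst w) (npair n
    (nat_rect (fun=> nat) (f (nfst w)) (S (nfst w)) n))); rewrite !npairE.
apply: eq_turing_le (turing_le_comp rP (turing_le_pair turing_le_id hP)) => z.
by rewrite !npairE.
Qed.

Lemma turing_le_pred f : turing_le f g -> turing_le (fun z => (f z).-1) g.
Proof.
move=> fP; apply: eq_turing_le (turing_le_rec (turing_le_cst 0)
  (S := fun _ n _ => n)
  (turing_le_fst (turing_le_snd turing_le_id)) fP) => z.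
by case: (f z).
Qed.

Lemma turing_le_add f h : turing_le f g -> turing_le h g ->
  turing_le (fun z => f z + h z) g.
Proof.
move=> fP hP; apply: eq_turing_le (turing_le_rec fP (S := fun _ _ m => m.+1)
  (turing_le_succ (turing_le_snd (turing_le_snd turing_le_id))) hP) => z.
by elim: (h z) => [|n /= ->]; rewrite ?addn0 ?addnS.
Qed.

Lemma turing_le_sub f h : turing_le f g -> turing_le h g ->
  turing_le (fun z => f z - h z) g.
Proof.
move=> fP hP; apply: eq_turing_le (turing_le_rec fP (S := fun _ _ m => m.-1)
  (turing_le_pred (turing_le_snd (turing_le_snd turing_le_id))) hP) => z.
by elim: (h z) => [|n /= ->]; rewrite ?subn0 ?subnS.
Qed.

Lemma turing_le_mul f h : turing_le f g -> turing_le h g ->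
  turing_le (fun z => f z * h z) g.
Proof.
move=> fP hP; apply: eq_turing_le (turing_le_rec (turing_le_cst 0)
  (S := fun z _ m => f z + m)
  (turing_le_add (turing_le_comp fP (turing_le_fst turing_le_id))
  (turing_le_snd (turing_le_snd turing_le_id))) hP) => z.
by elim: (h z) => [|n /= ->]; rewrite ?muln0 ?mulnS.
Qed.

Lemma turing_le_exp c f : turing_le f g -> turing_le (fun z => c ^ f z) g.
Proof.
move=> fP; apply: eq_turing_le (turing_le_rec (turing_le_cst 1)
  (S := fun _ _ m => c * m)
  (turing_le_mul (turing_le_cst c)
  (turing_le_snd (turing_le_snd turing_le_id))) fP) => z.
by elim: (f z) => [|n /= ->]; rewrite ?expnS.
Qed.

Lemma turing_le_neg P : turing_le (fun z => nat_of_bool (P z)) g ->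
  turing_le (fun z => nat_of_bool (~~ P z)) g.
Proof.
move=> PP; apply: eq_turing_le (turing_le_sub (turing_le_cst 1) PP) => z.
by case: (P z).
Qed.

Lemma turing_le_and P Q : turing_le (fun z => nat_of_bool (P z)) g ->
  turing_le (fun z => nat_of_bool (Q z)) g ->
  turing_le (fun z => nat_of_bool (P z && Q z)) g.
Proof.
move=> PP QP; apply: eq_turing_le (turing_le_mul PP QP) => z.
by rewrite mulnb.
Qed.

Lemma turing_le_or P Q : turing_le (fun z => nat_of_bool (P z)) g ->
  turing_le (fun z => nat_of_bool (Q z)) g ->
  turing_le (fun z => nat_of_bool (P z || Q z)) g.
Proof.
move=> PP QP.
apply: eq_turing_le (turing_le_neg
  (turing_le_and (turing_le_neg PP) (turing_le_neg QP))) => z.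
by rewrite negb_and !negbK.
Qed.

Lemma turing_le_odd f : turing_le f g ->
  turing_le (fun z => nat_of_bool (odd (f z))) g.
Proof.
move=> fP; apply: eq_turing_le (turing_le_rec (turing_le_cst 0)
  (S := fun _ _ m => 1 - m)
  (turing_le_sub (turing_le_cst 1)
  (turing_le_snd (turing_le_snd turing_le_id))) fP) => z.
by elim: (f z) => [|n /= ->] //=; case: odd.
Qed.

Lemma turing_le_half f : turing_le f g -> turing_le (fun z => (f z)./2) g.
Proof.
move=> fP; apply: eq_turing_le (turing_le_rec (turing_le_cst 0)
  (S := fun _ n m => odd n + m)
  (turing_le_add (turing_le_odd (turing_le_fst (turing_le_snd turing_le_id)))
  (turing_le_snd (turing_le_snd turing_le_id))) fP) => z.
by elim: (f z) => [|n /= ->] //=; rewrite uphalf_half.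
Qed.

Lemma turing_le_leq f h : turing_le f g -> turing_le h g ->
  turing_le (fun z => nat_of_bool (f z <= h z)) g.
Proof.
move=> fP hP; apply: eq_turing_le (turing_le_sub (turing_le_cst 1)
  (turing_le_sub fP hP)) => z.
by rewrite /leq; case: (f z - h z).
Qed.

Lemma turing_le_eq f h : turing_le f g -> turing_le h g ->
  turing_le (fun z => nat_of_bool (f z == h z)) g.
Proof.
move=> fP hP; apply: eq_turing_le (turing_le_and (turing_le_leq fP hP)
  (turing_le_leq hP fP)) => z.
by rewrite -eqn_leq.
Qed.

Lemma turing_le_eqb P Q : turing_le (fun z => nat_of_bool (P z)) g ->
  turing_le (fun z => nat_of_bool (Q z)) g ->
  turing_le (fun z => nat_of_bool (P z == Q z)) g.
Proof.
move=> PP QP; apply: eq_turing_le (turing_le_eq PP QP) => z.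
by case: (P z) (Q z) => [] [].
Qed.

Lemma turing_le_if P f h : turing_le (fun z => nat_of_bool (P z)) g ->
  turing_le f g -> turing_le h g ->
  turing_le (fun z => if P z then f z else h z) g.
Proof.
move=> PP fP hP; apply: eq_turing_le (turing_le_add (turing_le_mul PP fP)
  (turing_le_mul (turing_le_neg PP) hP)) => z.
by case: (P z); rewrite ?mul1n ?mul0n ?addn0.
Qed.

Lemma turing_le_iter f h (F : nat -> nat) : turing_le F g -> turing_le f g ->
  turing_le h g -> turing_le (fun z => iter (h z) F (f z)) g.
Proof.
move=> FP fP hP; apply: eq_turing_le (turing_le_rec fP (S := fun _ _ m => F m)
  (turing_le_comp FP (turing_le_snd (turing_le_snd turing_le_id))) hP) => z.
by elim: (h z) => [|n /= ->].
Qed.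

Lemma turing_le_count (P : nat -> nat -> bool) f :
  turing_le (fun w => nat_of_bool (P (nfst w) (nsnd w))) g -> turing_le f g ->
  turing_le (fun z => count (P z) (iota 0 (f z))) g.
Proof.
move=> PP fP.
have SP : turing_le (fun w => nsnd (nsnd w) + P (nfst w) (nfst (nsnd w))) g.
  apply: turing_le_add; first exact/turing_le_snd/turing_le_snd/turing_le_id.
  apply: eq_turing_le (turing_le_comp PP (turing_le_pair
    (turing_le_fst turing_le_id)
    (turing_le_fst (turing_le_snd turing_le_id)))) => w.
  by rewrite !npairE.
apply: eq_turing_le (turing_le_rec (turing_le_cst 0)
  (S := fun z n m => m + P z n) SP fP) => z.
elim: (f z) => [|n IHn] //.
by rewrite -[in RHS]addn1 iotaD count_cat -IHn /= addn0.
Qed.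

Lemma turing_le_all (P : nat -> nat -> bool) f :
  turing_le (fun w => nat_of_bool (P (nfst w) (nsnd w))) g -> turing_le f g ->
  turing_le (fun z => nat_of_bool (all (P z) (iota 0 (f z)))) g.
Proof.
move=> PP fP; apply: eq_turing_le
  (turing_le_eq (turing_le_count PP fP) fP) => z.
by rewrite -[X in _ == X](size_iota 0) -all_count.
Qed.

(** [Mu] searches for a value 0, hence the negated predicate is programmed; the existence hypothesis
    makes the search halt on every input. *)
Lemma turing_le_mu (P : nat -> nat -> bool) :
  turing_le (fun w => nat_of_bool (P (nfst w) (nsnd w))) g ->
  (forall z, exists n, P z n) ->
  exists2 h, turing_le h g &
    forall z, P z (h z) /\ forall m, m < h z -> ~~ P z m.
Proof.
move=> /turing_le_neg[p pP] Pex; exists (fun z => ex_minn (Pex z)); last first.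
  move=> z; case: ex_minnP => n Pn nmin; split=> // m.
  by apply: contraTN => /nmin; rewrite leqNgt.
exists (Mu p) => z; case: ex_minnP => n Pn nmin.
apply: ev_mu; first by have := pP (npair z n); rewrite !npairE Pn.
move=> m mn; exists 0; have := pP (npair z m); rewrite !npairE.
by case: (P z m) (nmin m) => // /(_ isT); rewrite leqNgt mn.
Qed.

End Closure.

Lemma turing_le_comp2 g (F : nat -> nat -> nat) f h :
  turing_le (fun w => F (nfst w) (nsnd w)) g ->
  turing_le f g -> turing_le h g -> turing_le (fun z => F (f z) (h z)) g.
Proof.
move=> FP fP hP; apply: eq_turing_le (turing_le_comp FP (turing_le_pair fP hP)).
by move=> z; rewrite !npairE.
Qed.

(** Placeholders, redefined as soon as the closure lemmas for list codes, strings and stages are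
    proved. *)
Ltac turing_le_list_step := fail.
Ltac turing_le_string_step := fail.
Ltac turing_le_stage_step := fail.

(* Syntax-directed: under a binder (bounded quantifier, recursion), the
   ambient variable becomes the first component of a pair. *)
Ltac turing_le_step :=
  lazymatch goal with
  | |- turing_le nfst _ => exact: (turing_le_fst (turing_le_id _))
  | |- turing_le nsnd _ => exact: (turing_le_snd (turing_le_id _))
  | |- turing_le (fun z => z) _ => apply: turing_le_id
  | |- turing_le (fun z => npair (@?f z) (@?h z)) _ =>
      apply: (@turing_le_pair _ f h)
  | |- turing_le (fun z => (@?f z).+1) _ => apply: (@turing_le_succ _ f)
  | |- turing_le (fun z => nfst (@?f z)) _ => apply: (@turing_le_fst _ f)
  | |- turing_le (fun z => nsnd (@?f z)) _ => apply: (@turing_le_snd _ f)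
  | |- turing_le (fun z => (@?f z).-1) _ => apply: (@turing_le_pred _ f)
  | |- turing_le (fun z => @?f z + @?h z) _ => apply: (@turing_le_add _ f h)
  | |- turing_le (fun z => @?f z - @?h z) _ => apply: (@turing_le_sub _ f h)
  | |- turing_le (fun z => @?f z * @?h z) _ => apply: (@turing_le_mul _ f h)
  | |- turing_le (fun z => ?c ^ @?h z) _ => apply: (@turing_le_exp _ c h)
  | |- turing_le (fun z => (@?f z)./2) _ => apply: (@turing_le_half _ f)
  | |- turing_le (fun z => count (@?P z) (iota 0 (@?f z))) _ =>
      apply: (@turing_le_count _ P f)
  | |- turing_le (fun z => nat_of_bool (~~ @?P z)) _ =>
      apply: (@turing_le_neg _ P)
  | |- turing_le (fun z => nat_of_bool (@?P z && @?Q z)) _ =>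
      apply: (@turing_le_and _ P Q)
  | |- turing_le (fun z => nat_of_bool (@?P z || @?Q z)) _ =>
      apply: (@turing_le_or _ P Q)
  | |- turing_le (fun z => nat_of_bool (odd (@?f z))) _ =>
      apply: (@turing_le_odd _ f)
  | |- turing_le (fun z => nat_of_bool (@?f z <= @?h z)) _ =>
      apply: (@turing_le_leq _ f h)
  | |- turing_le (fun z => nat_of_bool (@eq_op _ (@?f z) (@?h z))) _ =>
      first [apply: (@turing_le_eq _ f h) | apply: (@turing_le_eqb _ f h)]
  | |- turing_le (fun z => nat_of_bool (all (@?P z) (iota 0 (@?f z)))) _ =>
      apply: (@turing_le_all _ P f)
  | |- turing_le (fun z => nat_rect _ (@?f z) (@?S z) (@?h z)) _ =>
      apply: (@turing_le_rec _ f h S)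
  | H : turing_le (fun z => nat_of_bool (?P z)) ?g
    |- turing_le (fun z => nat_of_bool (?P (@?f z))) ?g =>
      refine (@turing_le_comp g _ f H _)
  | H : turing_le (fun w => nat_of_bool (?P (nfst w) (nsnd w))) ?g
    |- turing_le (fun z => nat_of_bool (?P (@?f z) (@?h z))) ?g =>
      refine (@turing_le_comp2 g (fun a b => nat_of_bool (P a b)) f h H _ _)
  | H : turing_le ?F ?g |- turing_le (fun z => ?F (@?f z)) ?g =>
      refine (@turing_le_comp g F f H _)
  | H : turing_le (fun w => ?F (nfst w) (nsnd w)) ?g
    |- turing_le (fun z => ?F (@?f z) (@?h z)) ?g =>
      refine (@turing_le_comp2 g F f h H _ _)
  | |- _ => first [turing_le_list_step | turing_le_string_step |
                  turing_le_stage_step]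
  end.

Ltac turing_le_auto := repeat (first [assumption | progress turing_le_step |
  apply: turing_le_cst]).

(** * Finite lists coded by numbers *)

Fixpoint lcode (l : seq nat) : nat :=
  if l is a :: l' then (npair a (lcode l')).+1 else 0.

Definition ldrop (i c : nat) : nat := iter i (fun c => nsnd c.-1) c.

Definition lnth (c i : nat) : nat := nfst (ldrop i c).-1.

(** Positions run up to [c] because a list is no longer than its code; those past the end are
    discarded by [ldrop i c != 0]. *)
Definition lcount (Q : pred nat) (c : nat) : nat :=
  count (fun i => (ldrop i c != 0) && Q (lnth c i)) (iota 0 c).

Definition lhas (Q : pred nat) (c : nat) : bool := 0 < lcount Q c.

Lemma lcode_surj c : exists l, c = lcode l.
Proof.
elim/ltn_ind: c => -[_|c IHc]; first by exists [::].
have [|l lE] := IHc (nsnd c).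
  by rewrite ltnS -{2}(npair_eta c) leq_npair.
by exists (nfst c :: l); rewrite /= -lE npair_eta.
Qed.

Lemma size_lcode l : size l <= lcode l.
Proof. by elim: l => //= a l /leq_trans; apply; exact: leq_npair. Qed.

Lemma ldrop0 i : ldrop i 0 = 0.
Proof. by elim: i => //= i ->. Qed.

Lemma ldrop_lcode i l : ldrop i (lcode l) = lcode (drop i l).
Proof.
elim: l i => [|a l IHl] [|i] //; first exact: ldrop0.
by rewrite /ldrop iterSr /= nsndE -IHl.
Qed.

Lemma lnth_lcode l i : lnth (lcode l) i = nth 0 l i.
Proof.
rewrite /lnth ldrop_lcode -[in RHS](addn0 i) -nth_drop.
by case: (drop i l) => [|a m] /=; rewrite ?nfstE.
Qed.

Lemma lcount_lcode Q l : lcount Q (lcode l) = count Q l.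
Proof.
rewrite /lcount -[X in iota 0 X](subnKC (size_lcode l)) iotaD count_cat add0n.
rewrite [X in _ + X](_ : _ = 0) ?addn0; last first.
  apply/eqP; rewrite -leqn0 leqNgt -has_count; apply/hasPn => i.
  by rewrite mem_iota => /andP[il _]; rewrite ldrop_lcode drop_oversize.
rewrite -[in RHS](mkseq_nth 0 l) count_map; apply: eq_in_count => i.
rewrite mem_iota add0n => /andP[_ il].
by rewrite lnth_lcode ldrop_lcode (drop_nth 0).
Qed.

Lemma lhas_lcode Q l : lhas Q (lcode l) = has Q l.
Proof. by rewrite /lhas lcount_lcode has_count. Qed.

Section ListClosure.
Variable g : nat -> nat.

Lemma turing_le_ldrop f h : turing_le f g -> turing_le h g ->
  turing_le (fun z => ldrop (f z) (h z)) g.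
Proof.
move=> fP hP; apply: (turing_le_iter (F := fun c => nsnd c.-1)) => //.
by turing_le_auto.
Qed.

Lemma turing_le_lnth f h : turing_le f g -> turing_le h g ->
  turing_le (fun z => lnth (f z) (h z)) g.
Proof.
move=> fP hP; rewrite /lnth; do 2 turing_le_step.
exact: turing_le_ldrop.
Qed.

Lemma turing_le_lcount (Q : nat -> nat -> bool) f :
  turing_le (fun w => nat_of_bool (Q (nfst w) (nsnd w))) g -> turing_le f g ->
  turing_le (fun z => lcount (Q z) (f z)) g.
Proof.
move=> QP fP; rewrite /lcount; turing_le_auto.
  by apply: turing_le_ldrop; turing_le_auto.
by apply: turing_le_lnth; turing_le_auto.
Qed.

Lemma turing_le_lhas (Q : nat -> nat -> bool) f :
  turing_le (fun w => nat_of_bool (Q (nfst w) (nsnd w))) g -> turing_le f g ->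
  turing_le (fun z => nat_of_bool (lhas (Q z) (f z))) g.
Proof.
by move=> QP fP; rewrite /lhas; turing_le_auto; exact: turing_le_lcount.
Qed.

End ListClosure.

Ltac turing_le_list_step ::=
  lazymatch goal with
  | |- turing_le (fun z => ldrop (@?f z) (@?h z)) _ =>
      apply: (@turing_le_ldrop _ f h)
  | |- turing_le (fun z => lnth (@?f z) (@?h z)) _ =>
      apply: (@turing_le_lnth _ f h)
  | |- turing_le (fun z => lcount (@?Q z) (@?f z)) _ =>
      apply: (@turing_le_lcount _ Q f)
  | |- turing_le (fun z => nat_of_bool (lhas (@?Q z) (@?f z))) _ =>
      apply: (@turing_le_lhas _ Q f)
  end.

(* A triple [<e, <x, y>>] asserts that program number [e] maps [x] to [y]; it
   is justified by the earlier triples of a list, seen through [H Q], which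
   says that some earlier triple satisfies [Q]. *)
Definition justified (H : pred nat -> bool) (t : nat) : bool :=
  let e := nfst t in let x := nfst (nsnd t) in let y := nsnd (nsnd t) in
  let d := nsnd e in let a := nfst d in let b := nsnd d in
  [|| (nfst e == 0) && (y == 0),
      (nfst e == 1) && (y == x.+1),
      (nfst e == 2) && (y == nfst x),
      (nfst e == 3) && (y == nsnd x),
      (nfst e == 4) && (y == 0),
      [&& nfst e == 5, H (fun s => s == npair a (npair x (nfst y)))
        & H (fun s => s == npair b (npair x (nsnd y)))],
      (nfst e == 6) &&
        H (fun s => [&& nfst s == b, nfst (nsnd s) == x
          & H (fun u => u == npair a (npair (nsnd (nsnd s)) y))]),
      [&& nfst e == 7, nsnd x == 0
        & H (fun s => s == npair a (npair (nfst x) y))],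
      [&& nfst e == 7, nsnd x != 0
        & H (fun s => [&& nfst s == e,
            nfst (nsnd s) == npair (nfst x) (nsnd x).-1
          & H (fun u => u == npair b (npair (npair (nfst x)
              (npair (nsnd x).-1 (nsnd (nsnd s)))) y))])]
    | [&& nfst e == 8, H (fun s => s == npair d (npair (npair x y) 0))
        & all (fun m => H (fun s => [&& nfst s == d,
            nfst (nsnd s) == npair x m & 0 < nsnd (nsnd s)])) (iota 0 y)]].

Fixpoint certificate (l : seq nat) : bool :=
  if l is t :: l' then justified (fun Q => has Q l') t && certificate l'
  else true.

(** The recursion of [certificate] on the list becomes a bounded quantifier over positions, each
    entry being justified by the entries behind it. *)
Definition certificate_code (c : nat) : bool :=
  all (fun i => (ldrop i c == 0) ||
    justified (fun Q => lhas Q (ldrop i.+1 c)) (lnth c i)) (iota 0 c).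

Lemma certificate_codeE l : certificate_code (lcode l) = certificate l.
Proof.
have -> : certificate l = all (fun i => justified
    (fun Q => has Q (drop i.+1 l)) (nth 0 l i)) (iota 0 (size l)).
  elim: l => //= t l ->; rewrite drop0; congr (_ && _).
  by rewrite (iotaDl 1 0) all_map; apply: eq_all.
rewrite /certificate_code -[X in iota 0 X](subnKC (size_lcode l)) iotaD.
rewrite all_cat add0n andbC.
rewrite [X in X && _](_ : _ = true); last first.
  apply/allP => i; rewrite mem_iota => /andP[il _].
  by rewrite ldrop_lcode drop_oversize.
apply: eq_in_all => i; rewrite mem_iota add0n => /andP[_ il].
rewrite lnth_lcode !ldrop_lcode {1}(drop_nth 0) // orFb.
congr justified; apply/funext => Q; exact: lhas_lcode.
Qed.

Lemma turing_le_certificate_code g :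
  turing_le (fun c => nat_of_bool (certificate_code c)) g.
Proof. rewrite /certificate_code /justified; turing_le_auto. Qed.

(** [H] occurs only positively in [justified], so more premises justify more. *)
Lemma justifiedS l l' t : {subset l <= l'} ->
  justified (fun Q => has Q l) t -> justified (fun Q => has Q l') t.
Proof.
move=> ll'.
have sub_has (Q Q' : pred nat) :
    (forall s, Q s -> Q' s) -> has Q l -> has Q' l'.
  by move=> QQ' /hasP[s /ll' sl' /QQ' ?]; apply/hasP; exists s.
have sub (Q : pred nat) : has Q l -> has Q l' by exact: sub_has.
rewrite /justified; repeat
  (case/orP => [H|]; [apply/orP; left|move=> H; apply/orP; right; move: H]);
  try exact: H.
- by case/and3P: H => -> /sub -> /sub ->.
- case/andP: H => ->; apply: sub_has => s /and3P[-> ->]; exact: sub.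
- by case/and3P: H => -> -> /sub ->.
- case/and3P: H => -> ->; apply: sub_has => s /and3P[-> ->]; exact: sub.
- case/and3P => -> /sub -> /allP H; apply/allP => m /H; exact: sub.
Qed.

Lemma certificate_cat l l' :
  certificate l -> certificate l' -> certificate (l ++ l').
Proof.
move=> + cl'; elim: l => //= t l IHl /andP[+ /IHl ->]; rewrite andbT.
by apply: justifiedS => s sl; rewrite mem_cat sl.
Qed.

(** The tag of [goedel p] leaves a single clause of [justified], which is the matching case of
    [computesP] with premises in the tail; induction on the list applies to these. *)
Lemma certificate_sound l : certificate l -> forall p x y,
  npair (goedel p) (npair x y) \in l -> computes (cst 0) p x y.
Proof.
elim: l => //= t l IHl /andP[tl /IHl {}IHl] p x y.
rewrite inE => /orP[/eqP tE|]; last exact: IHl.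
move: tl; rewrite -{}tE /justified !npairE.
have mem_has e u v : has (fun s => s == npair e (npair u v)) l ->
    npair e (npair u v) \in l.
  by move=> /hasP[s sl /eqP <-].
case: p => [|||||p q|p q|p q|p] /=; rewrite ?npairE ?orbF /= => H;
  apply/computesP; try exact/eqP.
- by case/andP: H => /mem_has/IHl ? /mem_has/IHl.
- case/hasP: H => s sl /and3P[/eqP sq /eqP sx /mem_has/IHl ?].
  exists (nsnd (nsnd s)) => //; apply: IHl.
  by rewrite -sq -sx !npair_eta.
- case: (nsnd x) H => [|n] /=; rewrite ?orbF; first by move=> /mem_has/IHl.
  move=> /hasP[s sl /and3P[/eqP sq /eqP sx /mem_has/IHl ?]].
  exists (nsnd (nsnd s)) => //; apply: IHl.
  by rewrite -sx /= -sq !npair_eta.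
- case/andP: H => /mem_has/IHl ? /allP H; split=> // m my.
  have := H m; rewrite mem_iota => /(_ my)/hasP[s sl].
  move=> /and3P[/eqP sp /eqP sx s0]; exists (nsnd (nsnd s)).-1.
  by apply: IHl; rewrite prednK // -sp -sx !npair_eta.
Qed.

Definition derivable (t : nat) : Prop := exists2 l, certificate l & t \in l.

(** Certificates can be concatenated, so one list serves finitely many facts at once. *)
Lemma derivable_all (l : seq nat) : (forall t, t \in l -> derivable t) ->
  exists2 l', certificate l' & {subset l <= l'}.
Proof.
elim: l => [|t l IHl] H; first by exists [::].
have [l' cl' ll'] : exists2 l', certificate l' & {subset l <= l'}.
  by apply: IHl => s sl; apply: H; rewrite inE sl orbT.
have [l'' cl'' tl''] := H t (mem_head _ _).
exists (l'' ++ l'); first exact: certificate_cat.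
move=> s; rewrite inE mem_cat => /orP[/eqP ->|/ll' ->]; first by rewrite tl''.
by rewrite orbT.
Qed.

Lemma derivable_from (l : seq nat) t : (forall t, t \in l -> derivable t) ->
  justified (fun Q => has Q l) t -> derivable t.
Proof.
move=> /derivable_all[l' cl' ll'] tl.
exists (t :: l'); last exact: mem_head.
by rewrite /= cl' (justifiedS ll').
Qed.

Lemma certificate_complete p x y : computes (cst 0) p x y ->
  derivable (npair (goedel p) (npair x y)).
Proof.
elim: p x y => [|||||p IHp q IHq|p IHp q IHq|p IHp q IHq|p IHp] x y
  /computesP.
1-5: by move=> ->; eexists [:: _]; last exact: mem_head;
  rewrite /= /justified /= ?npairE /= ?eqxx.
- move=> [/IHp px /IHq qx].
  apply: (@derivable_from [:: npair (goedel p) (npair x (nfst y));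
    npair (goedel q) (npair x (nsnd y))]).
    by move=> t; rewrite !inE => /orP[] /eqP ->.
  by rewrite /justified /= !npairE !eqxx /= orbT.
- move=> [v /IHq qx /IHp pv].
  apply: (@derivable_from [:: npair (goedel p) (npair v y);
    npair (goedel q) (npair x v)]).
    by move=> t; rewrite !inE => /orP[] /eqP ->.
  by rewrite /justified /= !npairE !eqxx /= !orbT.
- rewrite -(npair_eta x); move: (nfst x) (nsnd x) => {}x n; rewrite !npairE.
  elim: n y => [|n IHn] y.
    move=> /IHp px; apply: (@derivable_from [:: npair (goedel p) (npair x y)]).
      by move=> t; rewrite !inE => /eqP ->.
    by rewrite /justified /= !npairE !eqxx.
  move=> [v /computesP]; rewrite !npairE => /IHn px /IHq qv.
  apply: (@derivable_from [:: npair (goedel q) (npair (npair x (npair n v)) y);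
    npair (goedel (Prec p q)) (npair (npair x n) v)]).
    by move=> t; rewrite !inE => /orP[] /eqP ->.
  by rewrite /justified /= !npairE !eqxx /= !orbT.
- move=> [/IHp p0 pS].
  (* Finitely many premises suffice for [Mu]: a positive value for each [m < y], besides the value 0
     at [y]. *)
  have /choice[k kP] : forall m, exists k, m < y ->
      derivable (npair (goedel p) (npair (npair x m) k.+1)).
    move=> m; case: (ltnP m y) => [/pS[k /IHp ?]|_]; last by exists 0.
    by exists k.
  apply: (@derivable_from (npair (goedel p) (npair (npair x y) 0) ::
    [seq npair (goedel p) (npair (npair x m) (k m).+1) | m <- iota 0 y])).
    move=> t; rewrite inE => /orP[/eqP ->//|/mapP[m]].
    by rewrite mem_iota => /kP ? ->.
  rewrite /justified /= !npairE !eqxx /=; apply/allP => m my; apply/orP; right.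
  apply/hasP; exists (npair (goedel p) (npair (npair x m) (k m).+1)).
    by apply/mapP; exists m.
  by rewrite !npairE !eqxx.
Qed.

(* Kleene's T predicate; [y] pairs the witness of the projection with a
   certificate. *)
Definition kleeneT (e x y : nat) : bool :=
  certificate_code (nsnd y) &&
  lhas (fun s => s == npair e (npair (npair x (nfst y)) 1)) (nsnd y).

Lemma turing_le_kleeneT g e x y :
  turing_le e g -> turing_le x g -> turing_le y g ->
  turing_le (fun z => nat_of_bool (kleeneT (e z) (x z) (y z))) g.
Proof.
move=> eP xP yP; have cP := turing_le_certificate_code g.
by rewrite /kleeneT; turing_le_auto.
Qed.

(** The index is the number of a program deciding the matrix, and the certificate records that it
    outputs 1. Conversely, a certificate for output 1 forces the matrix to hold, since outputs are
    unique. *)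
Lemma sigma01_kleeneT (S : set nat) : sigma01 (cst 0) S ->
  exists e, forall x, S x <-> exists y, kleeneT e x y.
Proof.
move=> [P [[p pP] ->]]; exists (goedel p) => x; split=> [[y Pxy]|[y]].
  have := pP (npair x y); rewrite Pxy.
  move=> /certificate_complete[l cl lP]; exists (npair y (lcode l)).
  rewrite /kleeneT !npairE certificate_codeE cl lhas_lcode.
  by apply/hasP; eexists; first exact: lP.
rewrite /kleeneT; have [l ->] := lcode_surj (nsnd y).
rewrite certificate_codeE lhas_lcode => /andP[/certificate_sound cl].
move=> /hasP[s sl /eqP sE]; rewrite {}sE in sl.
exists (nfst y); have := computes_fun (pP _) (cl _ _ _ sl).
by case: (P _).
Qed.

Lemma goedel_inj : injective goedel.
Proof.
elim=> [|||||p IHp q IHq|p IHp q IHq|p IHp q IHq|p IHp];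
  case=> [|||||p' q'|p' q'|p' q'|p'] //= /npair_inj[]// _.
1-3: by move=> /npair_inj[/IHp -> /IHq ->].
by move=> /IHp ->.
Qed.

(* A computable matrix followed by an unbounded existential quantifier is a
   halting problem for one fixed program. *)
Lemma turing_le_halting g (P : nat -> nat -> bool) :
  turing_le (fun w => nat_of_bool (P (nfst w) (nsnd w))) (cst 0) ->
  turing_le (real_fun halting_set) g ->
  turing_le (fun z => nat_of_bool `[< exists n, P z n >]) g.
Proof.
move=> /turing_le_neg[p pP] hg.
have -> : (fun z => nat_of_bool `[< exists n, P z n >]) =
    fun z => real_fun halting_set (npair (goedel (Mu p)) z).
  apply/funext => z; rewrite /real_fun /halting_set; congr nat_of_bool.
  apply/asboolP/asboolP => [Pz|[q [x [y []]]]].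
    exists (Mu p), z; case: (ex_minnP Pz) => n Pn nmin; exists n; split=> //.
    apply: ev_mu; first by have := pP (npair z n); rewrite !npairE Pn.
    move=> m mn; exists 0; have := pP (npair z m); rewrite !npairE.
    by case: (P z m) (nmin m) => // /(_ isT); rewrite leqNgt mn.
  move=> /npair_inj[/goedel_inj <- <-] /computesP[q0 _]; exists y.
  have := computes_fun (pP _) q0; rewrite !npairE.
  by case: (P z y).
exact: turing_le_comp hg (turing_le_pair (turing_le_cst _ _) (turing_le_id _)).
Qed.

(** * Strings and the stages of the construction *)

Lemma str_code_inj : injective str_code.
Proof.
elim=> [|a s IHs] [|b t] //= [e].
have /(congr1 odd) := e; rewrite !oddD !odd_double !oddb /= => ab.
have /(congr1 half) := e; rewrite ![_.*2 + _]addnC !half_bit_double => /IHs ->.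
by rewrite ab.
Qed.

Lemma str_code_surj c : exists s, str_code s = c.
Proof.
elim/ltn_ind: c => -[_|c IHc]; first by exists [::].
have [|s sE] := IHc c./2; first by rewrite ltnS; lia.
by exists (odd c :: s); rewrite /= sE addnC odd_double_half.
Qed.

(** Obtained by choice, yet harmless for computability: strings enter [turing_le] only through
    [str_code], which cancels [sdec]. *)
Definition sdec (c : nat) : seq bool := projT1 (cid (str_code_surj c)).

Lemma sdecK c : str_code (sdec c) = c.
Proof. by rewrite /sdec; case: cid. Qed.

Lemma str_codeK s : sdec (str_code s) = s.
Proof. by apply: str_code_inj; exact: sdecK. Qed.

(** The binary digits of [(str_code s).+1] are a leading 1 followed by [s] in reverse. *)
Lemma str_code_bounds s : 2 ^ size s <= (str_code s).+1 < 2 ^ (size s).+1.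
Proof.
elim: s => //= b s; rewrite !expnS.
by move: (2 ^ size s) => p; case: b => /=; lia.
Qed.

Lemma str_code_cat s t :
  str_code (s ++ t) = str_code s + 2 ^ size s * str_code t.
Proof.
elim: s => [|b s IHs] /=; first by rewrite mul1n.
by rewrite IHs expnS; move: (2 ^ size s) => p; lia.
Qed.

Lemma str_code_nseq k : str_code (nseq k false) = 2 ^ k - 1.
Proof.
by elim: k => //= k ->; have := expn_gt0 2 k; rewrite expnS; lia.
Qed.

(** [c.-1./2] is the code of the tail and the parity of [c.-1] is the head. On the code 0 both give
    0, which matches the default [false]. *)
Definition bit (c i : nat) : bool := odd (iter i (fun c => c.-1./2) c).-1.

Lemma bit_str_code s i : bit (str_code s) i = nth false s i.
Proof.
rewrite /bit; elim: s i => [|b s IHs] [|i] //.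
- by rewrite (_ : iter i.+1 _ _ = 0) //; elim: i.+1 => //= j ->.
- by rewrite /= oddD odd_double oddb.
- by rewrite iterSr /= addnC half_bit_double -IHs.
Qed.

Section StringClosure.
Variable g : nat -> nat.
Implicit Types (S U : nat -> seq bool) (f : nat -> nat).

Lemma turing_le_size S : turing_le (fun z => str_code (S z)) g ->
  turing_le (fun z => size (S z)) g.
Proof.
move=> SP.
(* By [str_code_bounds], the length is the least [n] with [c.+1 < 2 ^ n.+1]. *)
have [||h hg hP] := @turing_le_mu g (fun c n => c.+1 < 2 ^ n.+1).
- by turing_le_auto.
- by move=> c; exists c; exact: ltn_expl.
apply: eq_turing_le (turing_le_comp hg SP) => z.
have [lt_h h_min] := hP (str_code (S z)).
have /andP[le_S lt_S] := str_code_bounds (S z).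
apply/eqP; rewrite eqn_leq; apply/andP; split.
  by rewrite leqNgt; apply/negP => /h_min; rewrite lt_S.
rewrite -ltnS -(ltn_exp2l _ _ (ltnSn 1)).
exact: leq_ltn_trans le_S lt_h.
Qed.

Lemma turing_le_cat S U : turing_le (fun z => str_code (S z)) g ->
  turing_le (fun z => str_code (U z)) g ->
  turing_le (fun z => str_code (S z ++ U z)) g.
Proof.
move=> SP UP; have sP := turing_le_size SP.
apply: (@eq_turing_le _
  (fun z => str_code (S z) + 2 ^ size (S z) * str_code (U z))).
  by move=> z; rewrite str_code_cat.
by turing_le_auto.
Qed.

Lemma turing_le_nseq f : turing_le f g ->
  turing_le (fun z => str_code (nseq (f z) false)) g.
Proof.
move=> fP; apply: (@eq_turing_le _ (fun z => 2 ^ f z - 1)).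
  by move=> z; rewrite str_code_nseq.
by turing_le_auto.
Qed.

Lemma turing_le_sdec f : turing_le f g ->
  turing_le (fun z => str_code (sdec (f z))) g.
Proof. by apply: eq_turing_le => z; rewrite sdecK. Qed.

Lemma turing_le_nth S f : turing_le (fun z => str_code (S z)) g ->
  turing_le f g -> turing_le (fun z => nat_of_bool (nth false (S z) (f z))) g.
Proof.
move=> SP fP.
apply: (@eq_turing_le _ (fun z => nat_of_bool (bit (str_code (S z)) (f z)))).
  by move=> z; rewrite bit_str_code.
rewrite /bit; do 2 turing_le_step.
by apply: turing_le_iter => //; turing_le_auto.
Qed.

Lemma turing_le_if_str (P : nat -> bool) S U :
  turing_le (fun z => nat_of_bool (P z)) g ->
  turing_le (fun z => str_code (S z)) g ->
  turing_le (fun z => str_code (U z)) g ->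
  turing_le (fun z => str_code (if P z then S z else U z)) g.
Proof.
move=> PP SP UP; apply: eq_turing_le (turing_le_if PP SP UP) => z.
by case: (P z).
Qed.

Lemma turing_le_prefix_of (X : cantor_space) f :
  turing_le (real_fun X) g -> turing_le f g ->
  turing_le (fun z => str_code (prefix_of X (f z))) g.
Proof.
move=> XP fP.
(* Appending a bit [b] to a string of length [n] adds [2 ^ n * b.+1] to its code, as [[:: b]] has
   code [b.+1]. *)
apply: eq_turing_le (turing_le_rec (turing_le_cst _ 0)
  (S := fun _ n c => c + 2 ^ n * (real_fun X n).+1) _ fP); last first.
  by turing_le_auto.
move=> z; elim: (f z) => // n IHn.
by rewrite /prefix_of mkseqS -cats1 str_code_cat size_mkseq /= IHn.
Qed.

End StringClosure.

Definition marked (s : seq bool) (k : nat) (b : bool) : seq bool :=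
  s ++ (nseq k false ++ [:: true; b]).

(** [w] pairs the code of a suffix with a witness that the string so extended belongs to the [i]-th
    c.e. set. *)
Definition witness (i : nat) (s : seq bool) (k w : nat) : bool :=
  kleeneT i (str_code (marked s k true ++ sdec (nfst w))) (nsnd w).

(* The bit after the marker says whether a search for an element of the [i]-th
   c.e. set above the current string is successful; [n] is the successor of the
   witness that the search finds, or 0. *)
Definition extend (s : seq bool) (k n : nat) : seq bool :=
  if n == 0 then marked s k false else marked s k true ++ sdec (nfst n.-1).

(** The value 0 is accepted unconditionally: absence of witnesses is not decidable in general, while
    [least_witness] has to be. The bit after the marker separates 0 from the other values. *)
Definition least_witness (i : nat) (s : seq bool) (k n : nat) : bool :=
  (n == 0) || witness i s k n.-1 &&
    all (fun w => ~~ witness i s k w) (iota 0 n.-1).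

(* [h i] pairs the number of zeros with the search result of step [i]. *)
Fixpoint stage (h : nat -> nat) (e : nat) : seq bool :=
  if e is i.+1 then extend (stage h i) (nfst (h i)) (nsnd (h i)) else [::].

Definition history (h : nat -> nat) (e : nat) : bool :=
  all (fun i => least_witness i (stage h i) (nfst (h i)) (nsnd (h i)))
    (iota 0 e).

Ltac turing_le_string_step ::=
  lazymatch goal with
  | |- turing_le (fun z => nat_of_bool (kleeneT (@?e z) (@?x z) (@?y z))) _ =>
      apply: (@turing_le_kleeneT _ e x y)
  | |- turing_le (fun z => size (@?S z)) _ => apply: (@turing_le_size _ S)
  | |- turing_le (fun z => str_code (@?S z ++ @?U z)) _ =>
      apply: (@turing_le_cat _ S U)
  | |- turing_le (fun z => str_code (nseq (@?f z) false)) _ =>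
      apply: (@turing_le_nseq _ f)
  | |- turing_le (fun z => str_code (sdec (@?f z))) _ =>
      apply: (@turing_le_sdec _ f)
  | |- turing_le (fun z => nat_of_bool (nth false (@?S z) (@?f z))) _ =>
      apply: (@turing_le_nth _ S f)
  | |- turing_le (fun z => str_code (prefix_of ?X (@?f z))) _ =>
      apply: (@turing_le_prefix_of _ X f)
  end.

Section StageClosure.
Variable g : nat -> nat.

Lemma turing_le_witness i S k w :
  turing_le i g -> turing_le (fun z => str_code (S z)) g -> turing_le k g ->
  turing_le w g ->
  turing_le (fun z => nat_of_bool (witness (i z) (S z) (k z) (w z))) g.
Proof. by move=> iP SP kP wP; rewrite /witness /marked; turing_le_auto. Qed.

Lemma turing_le_extend S k n :
  turing_le (fun z => str_code (S z)) g -> turing_le k g -> turing_le n g ->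
  turing_le (fun z => str_code (extend (S z) (k z) (n z))) g.
Proof.
move=> SP kP nP; rewrite /extend /marked.
by apply: turing_le_if_str; turing_le_auto.
Qed.

Lemma turing_le_stage (h : nat -> nat -> nat) e :
  turing_le (fun w => h (nfst w) (nsnd w)) g -> turing_le e g ->
  turing_le (fun z => str_code (stage (h z) (e z))) g.
Proof.
move=> hP eP.
apply: eq_turing_le (turing_le_rec (turing_le_cst _ 0) (S := fun z i c =>
  str_code (extend (sdec c) (nfst (h z i)) (nsnd (h z i)))) _ eP).
  by move=> z; elim: (e z) => //= i ->; rewrite str_codeK.
by apply: turing_le_extend; turing_le_auto.
Qed.

Lemma turing_le_history (h : nat -> nat -> nat) e :
  turing_le (fun w => h (nfst w) (nsnd w)) g -> turing_le e g ->
  turing_le (fun z => nat_of_bool (history (h z) (e z))) g.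
Proof.
move=> hP eP; rewrite /history /least_witness.
turing_le_auto.
all: apply: turing_le_witness; turing_le_auto.
all: by apply: turing_le_stage; turing_le_auto.
Qed.

End StageClosure.

Ltac turing_le_stage_step ::=
  lazymatch goal with
  | |- turing_le (fun z => nat_of_bool
        (witness (@?i z) (@?S z) (@?k z) (@?w z))) _ =>
      apply: (@turing_le_witness _ i S k w)
  | |- turing_le (fun z => str_code (extend (@?S z) (@?k z) (@?n z))) _ =>
      apply: (@turing_le_extend _ S k n)
  | |- turing_le (fun z => str_code (stage (@?h z) (@?e z))) _ =>
      apply: (@turing_le_stage _ h e)
  | |- turing_le (fun z => nat_of_bool (history (@?h z) (@?e z))) _ =>
      apply: (@turing_le_history _ h e)
  end.

Lemma least_witness_uniq i s k n n' : (n == 0) = (n' == 0) ->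
  least_witness i s k n -> least_witness i s k n' -> n = n'.
Proof.
rewrite /least_witness.
case: n n' => [|n] [|n'] //= _ /andP[wn /allP nmin] /andP[wn' /allP n'min].
case: (ltngtP n n') => [lt|lt|-> //].
- by move: (n'min n); rewrite mem_iota lt wn => /(_ isT).
- by move: (nmin n'); rewrite mem_iota lt wn' => /(_ isT).
Qed.

(** * Reading the steps back from the real *)

Definition on (X : cantor_space) (s : seq bool) : Prop :=
  prefix_of X (size s) = s.

Lemma onP X s : on X s <-> forall i, i < size s -> X i = nth false s i.
Proof.
split=> [<- i|H]; first by rewrite size_mkseq => ?; rewrite nth_mkseq.
apply: (@eq_from_nth _ false); rewrite ?size_mkseq // => i ilt.
by rewrite nth_mkseq // H.
Qed.

Lemma on_prefix X s t : prefix s t -> on X t -> on X s.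
Proof.
move=> /prefixP[u ->] /onP H; apply/onP => i ilt.
by rewrite H ?nth_cat ?ilt // size_cat ltn_addr.
Qed.

Lemma on_marked X s k b : on X (marked s k b) ->
  [/\ forall j, j < k -> X (size s + j) = false, X (size s + k) = true
    & X (size s + k).+1 = b].
Proof.
move=> /onP H; rewrite /marked !size_cat size_nseq /= in H.
have E j : j < k + 2 ->
    X (size s + j) = nth false (nseq k false ++ [:: true; b]) j.
  move=> jk; rewrite H ?ltn_add2l //.
  by rewrite nth_cat ltnNge leq_addr /= addKn.
split=> [j jk||].
- rewrite E; last by lia.
  by rewrite nth_cat size_nseq jk nth_nseq jk.
- rewrite E; last by lia.
  by rewrite nth_cat size_nseq ltnn subnn.
- rewrite -addnS E; last by lia.
  by rewrite nth_cat size_nseq ltnNge leqnSn /= subSnn.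
Qed.

Lemma prefix_marked s k n : prefix (marked s k (n != 0)) (extend s k n).
Proof.
by rewrite /extend; case: eqP => _; [exact: prefix_refl|exact: prefix_prefix].
Qed.

Lemma prefix_extend s k n : prefix s (extend s k n).
Proof.
by apply: prefix_trans (prefix_marked s k n); exact: prefix_prefix.
Qed.

Lemma prefix_stage h i j : i <= j -> prefix (stage h i) (stage h j).
Proof.
move=> /subnKC <-; elim: (j - i) => [|n IHn].
  by rewrite addn0 prefix_refl.
by rewrite addnS; apply: prefix_trans IHn _; exact: prefix_extend.
Qed.

Lemma size_stage h e : e <= size (stage h e).
Proof.
elim: e => //= e IHe; have /size_prefix := prefix_marked (stage h e)
  (nfst (h e)) (nsnd (h e)).
by apply: leq_trans; rewrite !size_cat /=; lia.
Qed.

(** The first 1 after [s] gives the number of zeros, the next bit tells whether the search result is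
    0, and a nonzero result is the least witness. *)
Lemma extend_uniq X i s k n k' n' :
  least_witness i s k n -> least_witness i s k' n' ->
  on X (extend s k n) -> on X (extend s k' n') -> k = k' /\ n = n'.
Proof.
move=> wn wn' /(on_prefix (prefix_marked _ _ _))/on_marked[X0 X1 Xb].
move=> /(on_prefix (prefix_marked _ _ _))/on_marked[X0' X1' Xb'].
have kk' : k = k'.
  by case: (ltngtP k k') => // [/X0'|/X0]; rewrite ?X1 ?X1'.
split=> //; rewrite -{}kk' in wn' Xb'; apply: least_witness_uniq wn wn'.
by apply: negb_inj; rewrite -Xb -Xb'.
Qed.

(** The steps are recovered in order: as long as the stages agree, [extend_uniq] forces the next
    step of both histories. *)
Lemma stage_uniq X h h' e : history h e -> history h' e ->
  on X (stage h e) -> on X (stage h' e) ->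
  forall i, i < e -> nfst (h i) = nfst (h' i).
Proof.
move=> /allP He /allP He' Xh Xh'.
have Hi i : i < e -> stage h i = stage h' i ->
    nfst (h i) = nfst (h' i) /\ nsnd (h i) = nsnd (h' i).
  move=> ie E; apply: (@extend_uniq X i (stage h i)).
  - by apply: He; rewrite mem_iota.
  - by rewrite E; apply: He'; rewrite mem_iota.
  - exact: on_prefix (prefix_stage h ie) Xh.
  - by rewrite E; exact: on_prefix (prefix_stage h' ie) Xh'.
suff E i : i <= e -> stage h i = stage h' i.
  by move=> i ie; have [] := Hi i ie (E i (ltnW ie)).
elim: i => //= i IHi ie; have E := IHi (ltnW ie).
by have [-> ->] := Hi i ie E; rewrite E.
Qed.

Lemma eq_stage h h' e : (forall i, i < e -> h i = h' i) ->
  stage h e = stage h' e.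
Proof.
elim: e => //= e IHe hh'; rewrite IHe ?hh' // => i ie.
by apply: hh'; exact: ltnW.
Qed.

Lemma eq_history h h' e : (forall i, i < e -> h i = h' i) ->
  history h e = history h' e.
Proof.
move=> hh'; apply: eq_in_all => i; rewrite mem_iota => ie.
by rewrite hh' // (@eq_stage h h') // => j ji; apply: hh'; exact: ltn_trans ie.
Qed.

Lemma lnth_mkseq (h : nat -> nat) e i :
  i < e -> lnth (lcode (mkseq h e)) i = h i.
Proof. by move=> ie; rewrite lnth_lcode nth_mkseq. Qed.

(** Step [e] has [c e] possible numbers of zeros and two outcomes of the search, and these determine
    the extension; [2 * c e <= 2 ^ (c e).+1] gives the recursion for [M]. *)
Lemma stages_bounded (c : nat -> nat) (M : nat -> nat) :
  (forall e, M e.+1 = (M e + c e).+1) ->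
  forall e, exists2 L : seq (seq bool), size L <= 2 ^ M e &
    forall h, history h e -> (forall i, i < e -> nfst (h i) < c i) ->
      stage h e \in L.
Proof.
move=> ME; elim=> [|e [L sizeL LP]].
  exists [:: [::]] => [|h _ _]; last exact: mem_head.
  by rewrite expn_gt0.
(* [w] gives the only possible nonzero search result after [k] zeros above [s]. *)
have /choice[w wP] : forall sk : seq bool * nat, exists n,
    forall n', n' != 0 -> least_witness e sk.1 sk.2 n' -> n' = n.
  move=> [s k]; have [[n [n0 wn]]|no] := pselect (exists n,
      n != 0 /\ least_witness e s k n).
    exists n => n' n'0 wn'; apply: least_witness_uniq wn' wn.
    by rewrite (negPf n0) (negPf n'0).
  by exists 0 => n' n'0 wn'; case: no; exists n'.
exists [seq extend s kb.1 (if kb.2 then w (s, kb.1) else 0) | s <- L,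
    kb <- [seq (k, true) | k <- iota 0 (c e)] ++
          [seq (k, false) | k <- iota 0 (c e)]].
  rewrite size_allpairs size_cat !size_map size_iota ME -addnS expnD leq_mul //.
  by rewrite addnn -mul2n expnS leq_mul // ltnW // ltn_expl.
move=> h; rewrite /history -addn1 iotaD all_cat /= andbT add0n addn1.
move=> /andP[He we] hc.
apply/allpairsP; exists (stage h e, (nfst (h e), nsnd (h e) != 0)); split=> /=.
- by apply: LP => // i ie; apply: hc; exact: ltnW.
- have ce : nfst (h e) \in iota 0 (c e) by rewrite mem_iota hc.
  by rewrite mem_cat; case: (_ != 0); rewrite (map_f (pair^~ _) ce) ?orbT.
- case: ifP => [n0|/negbFE/eqP ->] //.
  by rewrite -(wP (_, _) _ n0 we).
Qed.

(** * The weakly 1-generic real *)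

(** The halting set decides in advance whether a search has a witness, so every search can be made
    to halt. *)
Lemma exists_history g f : turing_le f g ->
  turing_le (real_fun halting_set) g ->
  exists h, [/\ turing_le h g, forall i, nfst (h i) = f i,
    forall e, history h e
    & forall i, nsnd (h i) = 0 -> forall w, ~~ witness i (stage h i) (f i) w].
Proof.
move=> fP hg.
pose W z w := witness (nfst z) (sdec (nfst (nsnd z))) (nsnd (nsnd z)) w.
have WP g' : turing_le (fun w => nat_of_bool (W (nfst w) (nsnd w))) g'.
  by rewrite /W; turing_le_auto.
pose halts z := `[< exists w, W z w >].
have haltsP : turing_le (fun z => nat_of_bool (halts z)) g.
  exact: turing_le_halting (WP _) hg.
have {}WP := WP g.
(* The least such [n] is 0 exactly when there is no witness, and otherwise the successor of the
   least witness. *)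
have [||srch srchP srchE] := @turing_le_mu g (fun z n =>
    ((n == 0) && ~~ halts z) || ((n != 0) && W z n.-1)).
- by turing_le_auto.
- move=> z; have [[w Ww]|no] := asboolP (exists w, W z w).
    by exists w.+1; rewrite /= Ww.
  by exists 0; rewrite /= orbF; exact/asboolPn.
(* Each search depends on the stage it starts from, so the codes of the stages are computed first,
   by recursion, and [h] is read off from them. *)
pose step i c :=
  str_code (extend (sdec c) (f i) (srch (npair i (npair c (f i))))).
pose S e := nat_rect (fun=> nat) 0 step e.
pose h i := npair (f i) (srch (npair i (npair (S i) (f i)))).
have SP : turing_le S g.
  apply: (turing_le_rec (turing_le_cst _ 0) (S := fun _ => step) _
    (turing_le_id _)).
  by rewrite /step; turing_le_auto.
have stageE i : stage h i = sdec (S i).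
  elim: i => [|i IHi]; first exact: esym (str_codeK [::]).
  by rewrite /= {}IHi str_codeK /h !npairE.
exists h; split=> [|i|e|i]; rewrite /h ?npairE //.
- by turing_le_auto.
- apply/allP => i _; rewrite stageE !npairE /least_witness.
  have [] := srchE (npair i (npair (S i) (f i))).
  case: (srch _) => [//|n] /=; rewrite /W !npairE => -> nmin.
  apply/allP => w; rewrite mem_iota => /= wn.
  exact: nmin w.+1 wn.
- move=> n0; have [] := srchE (npair i (npair (S i) (f i))).
  rewrite n0 /= orbF => /asboolPn no _ w; apply/negP => Ww; apply: no; exists w.
  by rewrite /W !npairE -stageE.
Qed.

(** Every step adds at least the marker, so [stage h n.+1] has more than [n] bits and the default is
    never reached. *)
Definition real_of (h : nat -> nat) : cantor_space :=
  fun n => nth false (stage h n.+1) n.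

Lemma on_real_of h e : on (real_of h) (stage h e).
Proof.
apply/onP => i ie; rewrite /real_of.
have ii : i < size (stage h i.+1) by exact: size_stage.
have [/(prefix_stage h)/prefixP[u ->]|/ltnW/(prefix_stage h)/prefixP[u E]] :=
  leqP e i.+1; first by rewrite nth_cat ie.
by rewrite E nth_cat ii.
Qed.

Lemma turing_le_real_of g h : turing_le h g ->
  turing_le (real_fun (real_of h)) g.
Proof.
move=> hP; rewrite /real_fun /real_of.
apply: turing_le_nth; last exact: turing_le_id.
by turing_le_auto.
Qed.

(** Let [W] be the [i]-th c.e. set. Density above the [i]-th stage with marker bit [true] provides a
    witness, so the search of step [i] succeeds and the next stage lies in [W]. *)
Lemma real_of_weakly_1_generic h : (forall e, history h e) ->
  (forall i, nsnd (h i) = 0 ->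
    forall w, ~~ witness i (stage h i) (nfst (h i)) w) ->
  weakly_1_generic (real_of h).
Proof.
move=> hist stuck W /sigma01_kleeneT[i iP] dense_W.
have WP s : W s <-> exists y, kleeneT i (str_code s) y.
  rewrite -iP; split=> [Ws|[t Wt /str_code_inj <-]] //.
suff [s Ws Xs] : exists2 s, W s & on (real_of h) s.
  by exists (size s); rewrite Xs.
exists (stage h i.+1); last exact: on_real_of.
have [t /prefixP[u ->] /WP[y ty]] :=
  dense_W (marked (stage h i) (nfst (h i)) true).
have : least_witness i (stage h i) (nfst (h i)) (nsnd (h i)).
  by apply: (allP (hist i.+1)); rewrite mem_iota add0n ltnSn.
rewrite /least_witness [stage h i.+1]/= /extend.
case: eqVneq => [n0 _|n0 /andP[wit _]].
  have /negP[] := stuck i n0 (npair (str_code u) y).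
  by rewrite /witness !npairE str_codeK.
by apply/WP; eexists; exact: wit.
Qed.

(** Search for the code of any finite history whose stage is an initial segment of the real. The
    true one qualifies, and by [stage_uniq] all such histories have the same numbers of zeros. *)
Lemma turing_le_decode h : (forall e, history h e) ->
  turing_le (fun i => nfst (h i)) (real_fun (real_of h)).
Proof.
move=> hist; set X := real_of h.
have XP := turing_le_refl (real_fun X).
have [||d dP dE] := @turing_le_mu (real_fun X) (fun e c =>
  history (lnth c) e.+1 && (str_code (prefix_of X (size (stage (lnth c) e.+1)))
    == str_code (stage (lnth c) e.+1))).
- by turing_le_auto.
- move=> e; exists (lcode (mkseq h e.+1)).
  have E i : i < e.+1 -> lnth (lcode (mkseq h e.+1)) i = h i.
    exact: lnth_mkseq.
  rewrite (eq_history E) (eq_stage E) hist andTb; apply/eqP.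
  by congr str_code; exact: on_real_of.
apply: (@eq_turing_le _ (fun e => nfst (lnth (d e) e))) => [e|]; last first.
  by turing_le_auto.
have [/andP[hist' /eqP/str_code_inj Xs] _] := dE e.
by apply: (stage_uniq (X := X) hist' (hist e.+1) Xs) => //; exact: on_real_of.
Qed.

(** * Measures on Cantor space *)

Import Order.TTheory GRing.Theory Num.Theory.
Local Open Scope classical_set_scope.

Lemma cylinderE s : cylinder s = [set X | on X s].
Proof. by []. Qed.

Lemma cylinder_nil : cylinder [::] = setT.
Proof. by rewrite -subTset => X _; rewrite cylinderE. Qed.

Lemma cylinder_prefix s t : prefix s t -> cylinder t `<=` cylinder s.
Proof. by move=> st X; rewrite !cylinderE; exact: on_prefix. Qed.

Lemma open_cylinder s : open (cylinder s : set cantor_space).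
Proof.
elim/last_ind: s => [|s b IHs]; first by rewrite cylinder_nil; exact: openT.
rewrite (_ : cylinder _ = cylinder s `&`
    (@proj nat (fun=> bool) (size s) @^-1` [set b])); last first.
  apply/seteqP; split=> X; rewrite /cylinder /prefix_of /= size_rcons mkseqS.
    by move=> /rcons_inj[].
  by case=> -> Xb; congr rcons; exact: Xb.
apply: openI => //; apply: open_comp; last exact: discrete_open.
by move=> X _; exact: proj_continuous.
Qed.

Lemma open_measurable_cantor (U : set cantor_space) :
  open U -> measurable (U : set borel_cantor).
Proof. exact: sub_sigma_algebra. Qed.

Lemma measurable_cylinder s : measurable (cylinder s : set borel_cantor).
Proof. by apply: open_measurable_cantor; exact: open_cylinder. Qed.

Local Open Scope ring_scope.
Local Open Scope ereal_scope.

Section Measure.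
Variables (R : realType) (mu : probability borel_cantor R).

Lemma le_mu_cylinder s t : prefix s t -> mu (cylinder t) <= mu (cylinder s).
Proof.
move=> st; apply: le_measure; rewrite ?inE; try exact: measurable_cylinder.
exact: cylinder_prefix.
Qed.

Lemma mu_cylinder_seq (L : seq (seq bool)) :
  mu (\big[setU/set0]_(s <- L) cylinder s) <= \sum_(s <- L) mu (cylinder s).
Proof.
elim: L => [|s L IHL]; first by rewrite !big_nil measure0.
rewrite !big_cons; apply: le_trans (leeD2l _ IHL).
apply: measureU2; first exact: measurable_cylinder.
by apply: bigsetU_measurable => t _; exact: measurable_cylinder.
Qed.

(** Compactness: otherwise the strings with large cylinders form an infinite binary tree, and the
    cylinders along an infinite branch shrink to a point, whose measure would be at least [e]. *)
Lemma cylinder_small (e : R) : continuous_measure mu -> (0 < e)%R ->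
  exists l, forall s, size s = l -> mu (cylinder s) <= e%:E.
Proof.
move=> cont e0; apply: contrapT => no.
pose big s := e%:E < mu (cylinder s).
(* The node [s] has an infinite subtree of large strings. *)
pose P s := forall l, (size s <= l)%N ->
  exists t, [/\ size t = l, prefix s t & big t].
have P0 : P [::].
  move=> l _; apply: contrapT => no_l; apply: no; exists l => s sl.
  rewrite leNgt; apply/negP => bs; apply: no_l; exists s; split=> //.
  exact: prefix0s.
have big_prefix s t : prefix s t -> big t -> big s.
  by move=> st bt; apply: lt_le_trans bt _; exact: le_mu_cylinder.
have PS s : P s -> exists b, P (rcons s b).
  move=> Ps; apply: contrapT => /forallNP noP.
  have /choice[l lP] : forall b, exists l, (size s < l)%N /\
      forall t, size t = l -> prefix (rcons s b) t -> ~ big t.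
    move=> b; have /existsNP[l /not_implyP[sl nol]] := noP b.
    exists l; split; first by rewrite size_rcons in sl.
    by move=> t tl st bt; apply: nol; exists t.
  (* A large string reaching both failure lengths passes through one of the children, and its
     truncation to the failure length of that child is still large. *)
  have [|t [tl st bt]] := Ps (maxn (l true) (l false)).
    by rewrite leq_max; apply/orP; left; apply: ltnW; have [] := lP true.
  have [slb] := lP (nth false t (size s)).
  set b := nth _ _ _ in slb *.
  have lbt : (l b <= size t)%N.
    by rewrite tl leq_max; case: (b); rewrite leqnn ?orbT.
  move=> /(_ (take (l b) t)); apply.
  - by rewrite size_takel.
  - have -> : t = rcons s b ++ drop (size s).+1 t.
      rewrite -[LHS](cat_take_drop (size s).+1).
      congr (_ ++ _); rewrite (take_nth false) ?(leq_trans slb) //.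
      by congr rcons; move/prefixP: st => [u ->]; rewrite take_size_cat.
    by rewrite take_cat size_rcons ltnNge slb; exact: prefix_prefix.
  - by apply: big_prefix bt; exact: prefix_take.
have /choice[next nextP] : forall s, exists b, P s -> P (rcons s b).
  move=> s; have [/PS[b Pb]|nPs] := pselect (P s); first by exists b.
  by exists false.
pose path n := iter n (fun s => rcons s (next s)) [::].
pose x : cantor_space := fun n => next (path n).
have pathE n : path n = prefix_of x n.
  by elim: n => // n IHn; rewrite /prefix_of mkseqS -/(prefix_of x n) -IHn.
have Ppath n : P (path n) by elim: n => // n; exact: nextP.
have big_path n : big (path n).
  have [t [tn]] := Ppath n (size (path n)) (leqnn _).
  by move=> /prefixP[u tE] bt; rewrite tE size_cat -[RHS]addn0 in tn;
     move/addnI/eqP: tn; rewrite size_eq0 => /eqP u0;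
     rewrite tE u0 cats0 in bt.
have xE : \bigcap_n cylinder (path n) = [set x].
  apply/seteqP; split=> [y yx|y ->].
    apply/funext => n; have := yx n.+1 I.
    rewrite pathE cylinderE /= => /onP/(_ n).
    by rewrite size_mkseq => -> //; rewrite nth_mkseq.
  move=> n _; rewrite pathE cylinderE; apply/onP => i.
  by rewrite size_mkseq => ni; rewrite nth_mkseq.
pose F n : set borel_cantor := cylinder (path n).
have cvg_F : mu \o F @ \oo --> mu (\bigcap_n F n).
  apply: nonincreasing_cvg_mu.
  - by rewrite (le_lt_trans (probability_le1 _ _)) ?ltry //;
      exact: measurable_cylinder.
  - by move=> n; exact: measurable_cylinder.
  - by apply: bigcap_measurable => [|n _]; [exists 0%N|
      exact: measurable_cylinder].
  - move=> m n mn; apply/subsetPset; apply: cylinder_prefix.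
    rewrite !pathE -(subnKC mn) /prefix_of /mkseq iotaD map_cat.
    exact: prefix_prefix.
have : e%:E <= lim (mu \o F @ \oo).
  apply: lime_ge; first by apply/cvg_ex; eexists; exact: cvg_F.
  by apply: nearW => n; exact/ltW/big_path.
by rewrite (cvg_lim _ cvg_F) // xE cont lee_fin leNgt e0.
Qed.

End Measure.

(** * Cylinder measures computed from a representation *)

Definition agrees (l : nat) (s t : seq bool) : bool :=
  all (fun i => nth false s i == nth false t i) (iota 0 l).

(** The Dirac measure at [t 0 0 0 ...] charges the cylinder iff [t], padded by the default [false],
    agrees with it; hence a ratio of two counts, computable from the index. *)
Lemma avg_dirac_cylinder (R : realType) s l c n :
  avg_dirac R s l (cylinder (mkseq (nth false c) n)) =
  ((count (agrees n c) (s :: l))%:R / (size l).+1%:R)%:E.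
Proof.
rewrite /avg_dirac /mscale /= /msum.
rewrite (eq_bigr (fun i : 'I_(size l).+1 =>
  ((agrees n c (nth [::] (s :: l) i))%:R)%:E)); last first.
  move=> i _; rewrite /= /dirac indicE; congr (_%:R%:E); congr nat_of_bool.
  apply/idP/allP => [|H].
    rewrite inE cylinderE => /onP H j; rewrite mem_iota => jn.
    by have := H j; rewrite size_mkseq nth_mkseq // => <-.
  rewrite inE cylinderE; apply/onP => j; rewrite size_mkseq => jn.
  by rewrite nth_mkseq //; apply/esym/eqP/H; rewrite mem_iota.
rewrite sumEFin -EFinM -natr_sum mulrC; congr (_%:R / _)%:E.
rewrite -[RHS]/(count (agrees n c) (s :: l)) -sum1_count [RHS]big_mkcond.
by rewrite (big_nth [::]) big_mkord; apply: eq_bigr => i _; case: agrees.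
Qed.

Section Distance.
Variable R : realType.
Variables mu nu : probability borel_cantor R.

(** The difference occurs in the term of the metric at level [size s], with weight
    [2 ^- (size s).+1]. *)
Lemma cylinder_dist s : `|mu (cylinder s) - nu (cylinder s)| <=
  (2 ^+ (size s).+1)%:E * measure_dist mu nu.
Proof.
set d := fun s => `|mu (cylinder s) - nu (cylinder s)|.
have d0 t : 0 <= d t by exact: abse_ge0.
pose D n := (2 ^- n.+1)%:E * \sum_(t : n.-tuple bool) d t.
have D0 n : 0 <= D n.
  by apply: mule_ge0; [rewrite lee_fin invr_ge0 exprn_ge0|exact: sume_ge0].
have le_D : D (size s) <= measure_dist mu nu.
  apply: le_trans (@nneseries_lim_ge R D xpredT 0 (size s).+1 _); last by [].
  by rewrite big_nat_recr //= leeDr // sume_ge0.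
have le_d : d s <= (2 ^+ (size s).+1)%:E * D (size s).
  rewrite /D muleA -EFinM divff ?expf_neq0 // mul1e.
  rewrite (bigD1 (Tuple (eqxx (size s)))) //= leeDl //.
  exact: sume_ge0.
apply: le_trans le_d _; apply: lee_wpmul2l le_D.
by rewrite lee_fin exprn_ge0.
Qed.

Lemma fine_cylinder_dist s n : measure_dist mu nu <= (2 ^- n)%:E ->
  (`|fine (mu (cylinder s)) - fine (nu (cylinder s))| <=
   2 ^+ (size s).+1 * 2 ^- n)%R.
Proof.
move=> dn; have := cylinder_dist s.
have fin (m : probability borel_cantor R) :
    m (cylinder s) = (fine (m (cylinder s)))%:E.
  by rewrite fineK // fin_num_measure //; exact: measurable_cylinder.
rewrite (fin mu) (fin nu) -EFinB abse_EFin => /le_trans le_d.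
rewrite -lee_fin EFinM; apply: le_d; apply: lee_wpmul2l dn.
by rewrite lee_fin exprn_ge0.
Qed.

End Distance.

(** For each [k], search for a length at which a good approximation gives all cylinders measure at
    most [2 ^- k.+1]; with an error of at most [2 ^- k.+2] this keeps [mu] below [2 ^- k].
    Continuity makes the search halt. *)
Lemma representation_modulus (R : realType) (mu : probability borel_cantor R)
    (r : cantor_space) : continuous_measure mu -> representation mu r ->
  exists2 g, turing_le g (real_fun r) &
    forall n s, (g n <= size s)%N -> mu (cylinder s) <= (2 ^- n)%:E.
Proof.
move=> cont [q [rq qmu]].
have rP := turing_le_refl (real_fun r).
have [||idx idxP idxE] := @turing_le_mu (real_fun r) (fun n m => r (npair n m)).
- apply: (turing_le_comp rP (f := fun w => npair (nfst w) (nsnd w))).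
  by turing_le_auto.
- by move=> n; exists (measure_index (q n).1 (q n).2); rewrite rq.
pose L n := (q n).1 :: (q n).2.
(* The fold in [measure_index] has the shape of [lcode]; the successor turns the outer pair into a
   cons, so the whole nonempty list is coded. *)
have {}idxE n : (idx n).+1 = lcode (map str_code (L n)).
  have [+ _] := idxE n; rewrite rq => /eqP ->; rewrite /measure_index /=.
  congr (npair _ _).+1; elim: (q n).2 => //= t u -> //.
pose nu n := avg_dirac R (q n).1 (q n).2.
(* The codes below [2 ^ l.+1] include those of all strings of length [l]; other strings are cut or
   padded to that length. The inequality between measures is cleared of denominators. *)
pose small k l n := all (fun c =>
  (lcount (fun t => agrees l (sdec c) (sdec t)) (idx n).+1 * 2 ^ k.+1 <=
   lcount xpredT (idx n).+1)%N) (iota 0 (2 ^ l.+1)).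
have smallE k l n : small k l n <-> forall s, size s = l ->
    (fine (nu n (cylinder s)) <= 2 ^- k.+1)%R.
  have countE c : lcount (fun t => agrees l (sdec c) (sdec t)) (idx n).+1 =
      count (agrees l (sdec c)) (L n).
    rewrite idxE lcount_lcode count_map.
    by apply: eq_count => t /=; rewrite str_codeK.
  have le_nu c : (count (agrees l c) (L n) * 2 ^ k.+1 <=
        lcount xpredT (idx n).+1)%N =
      (fine (nu n (cylinder (mkseq (nth false c) l))) <= 2 ^- k.+1)%R.
    rewrite idxE lcount_lcode count_predT size_map /nu avg_dirac_cylinder.
    rewrite [fine _]/= ler_pdivrMr ?ltr0n // mulrC ler_pdivlMr ?exprn_gt0 //.
    by rewrite -natrX -natrM ler_nat.
  split=> [/allP H s sl|H].
    have /andP[_ lt_s] := str_code_bounds s.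
    have := H (str_code s); rewrite countE str_codeK le_nu mem_iota add0n -sl.
    by rewrite mkseq_nth; apply; exact: ltnW.
  by apply/allP => c _; rewrite countE le_nu; apply: H; rewrite size_mkseq.
have half k : (2 ^- k = 2 ^- k.+1 + 2 ^- k.+1 :> R)%R.
  by rewrite exprS invfM; field; rewrite expf_neq0.
have fin_mu s : mu (cylinder s) = (fine (mu (cylinder s)))%:E.
  by rewrite fineK // fin_num_measure //; exact: measurable_cylinder.
(* The index [l + k + 3] absorbs the factor [2 ^+ l.+1] of [fine_cylinder_dist] and leaves
   [2 ^- k.+2]. *)
have dist k l s : size s = l ->
    (`|fine (nu (l + k + 3)%N (cylinder s)) - fine (mu (cylinder s))| <=
     2 ^- k.+2)%R.
  move=> sl; apply: le_trans (fine_cylinder_dist s (qmu _)) _.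
  rewrite sl (_ : (l + k + 3 = l.+1 + k.+2)%N); last by lia.
  by rewrite exprD invfM mulrA divff ?mul1r // expf_neq0.
have [||g gP gE] := @turing_le_mu (real_fun r)
    (fun k l => small k l (l + k + 3)%N).
- by rewrite /small /agrees; turing_le_auto.
(* At some length [mu] is at most [2 ^- k.+2] on all cylinders, so the approximation is at most
   [2 ^- k.+1] there. *)
- move=> k; have [|l lP] := @cylinder_small R mu (2 ^- k.+2) cont.
    by rewrite invr_gt0 exprn_gt0.
  exists l; apply/smallE => s sl; have := dist k l s sl.
  have := lP s sl; rewrite fin_mu lee_fin ler_norml (half k.+1).
  lra.
exists g => // n s gs.
apply: le_trans (le_mu_cylinder _ (prefix_take s (g n))) _.
have sg := size_takel gs.
have [/smallE/(_ _ sg) small_n _] := gE n.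
rewrite fin_mu lee_fin; have := dist n _ _ sg; move: small_n.
rewrite ler_norml (half n) (half n.+1); have : (0 <= 2 ^- n.+2 :> R)%R.
  by rewrite invr_ge0 exprn_ge0.
lra.
Qed.

(** * Randomness tests *)

Section Tests.
Variables (R : realType) (mu : probability borel_cantor R) (r : cantor_space).
Variable g : nat -> nat.
Hypothesis g_le : turing_le g (real_fun r).
Hypothesis gP : forall n s, (g n <= size s)%N -> mu (cylinder s) <= (2 ^- n)%:E.

Lemma not_random_turing_le (X : cantor_space) :
  turing_le (real_fun X) (real_fun r) -> ~ random_for mu r X.
Proof.
move=> XP /(_ (fun n => cylinder (prefix_of X (g n)))); apply.
- exists (fun n s => s = prefix_of X (g n)); split; last first.
    by move=> n; rewrite bigcup_set1.
  exists (fun z => nsnd (nfst z) == str_code (prefix_of X (g (nfst (nfst z))))).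
  split; first by turing_le_auto.
  apply/seteqP; split=> z /=.
    by move=> [n [s [-> ->]]]; exists 0%N; rewrite !npairE.
  move=> [y]; rewrite !npairE => /eqP zE.
  exists (nfst z), (prefix_of X (g (nfst z))).
  by rewrite -zE npair_eta.
- by move=> n; apply: gP; rewrite size_mkseq.
- by move=> n _; rewrite cylinderE /= /on /prefix_of size_mkseq.
Qed.

(* [2 ^ weight n e] bounds the number of strings that the first [e] steps can
   produce if the number of zeros in step [i] stays below [bound n i]. *)
Definition weight (n e : nat) : nat :=
  nat_rect (fun=> nat) 0%N (fun i m => (m + g (n + i + 1 + m)).+1) e.

(** At most [2 ^ weight n e] cylinders of measure at most [2 ^- (n + e + 1 + weight n e)] together
    contribute at most [2 ^- (n + e + 1)], which sums to [2 ^- n] over [e]. The recursion of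
    [weight] contains [bound n i] unfolded. *)
Definition bound (n e : nat) : nat := g (n + e + 1 + weight n e).

(** Finite histories are coded by numbers through [lnth], which makes the set of these strings c.e.
    in [r]. *)
Definition test_string (n : nat) (s : seq bool) : Prop :=
  exists e c, [/\ history (lnth c) e, forall i, (i < e)%N ->
    (nfst (lnth c i) < bound n i)%N
    & s = stage (lnth c) e ++ nseq (bound n e) false].

Definition test (n : nat) : set cantor_space :=
  \bigcup_(s in test_string n) cylinder s.

Lemma turing_le_bound n e : turing_le n (real_fun r) ->
  turing_le e (real_fun r) ->
  turing_le (fun z => bound (n z) (e z)) (real_fun r).
Proof.
move=> nP eP; rewrite /bound.
have wP : turing_le (fun z => weight (n z) (e z)) (real_fun r).
  by rewrite /weight; turing_le_auto.
by turing_le_auto.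
Qed.

Lemma test_sigma01 : uniformly_sigma01 (real_fun r) test.
Proof.
exists test_string; split=> //.
have bP : turing_le (fun w => bound (nfst w) (nsnd w)) (real_fun r).
  by apply: turing_le_bound; turing_le_auto.
pose E z := nfst (nsnd z); pose C z := nsnd (nsnd z); pose N z := nfst (nfst z).
exists (fun z => [&& history (lnth (C z)) (E z),
  all (fun i => (nfst (lnth (C z) i)).+1 <= bound (N z) i)%N (iota 0 (E z)) &
  nsnd (nfst z) == str_code (stage (lnth (C z)) (E z) ++
    nseq (bound (N z) (E z)) false)]).
split; first by rewrite /C /E /N; turing_le_auto.
rewrite /E /C /N; apply/seteqP; split=> z /=.
  move=> [n [s [[e [c [hist small ->]]] ->]]]; exists (npair e c).
  rewrite !npairE hist eqxx andbT; apply/allP => i.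
  by rewrite mem_iota add0n => /small.
move=> [y]; rewrite !npairE => /and3P[hist /allP small /eqP zE].
exists (nfst z), (stage (lnth (nsnd y)) (nfst y) ++
  nseq (bound (nfst z) (nfst y)) false).
rewrite -zE npair_eta; split=> //; exists (nfst y), (nsnd y); split=> // i iy.
by apply: small; rewrite mem_iota.
Qed.

Lemma mu_test n : mu (test n) <= (2 ^- n)%:E.
Proof.
have /choice[L LP] : forall e, exists L : seq (seq bool),
    (size L <= 2 ^ weight n e)%N /\ forall h, history h e ->
      (forall i, (i < e)%N -> (nfst (h i) < bound n i)%N) -> stage h e \in L.
  move=> e; have [//|L sL LP] := @stages_bounded (bound n) (weight n) _ e.
  by exists L.
pose B e : set borel_cantor :=
  \big[setU/set0]_(s <- [seq s ++ nseq (bound n e) false | s <- L e])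
    cylinder s.
have muB e : mu (B e) <= (2 ^- n / (2 ^ e.+1)%:R)%:E.
  apply: le_trans (mu_cylinder_seq _ _) _; rewrite big_map.
  apply: (@le_trans _ _ (\sum_(s <- L e) (2 ^- (n + e + 1 + weight n e))%:E)).
    apply: lee_sum => s _; apply: gP.
    by rewrite size_cat size_nseq -/(bound n e) leq_addl.
  rewrite sumEFin big_const_seq count_predT iter_addr_0 lee_fin.
  rewrite -[(_ *+ size _)%R]mulr_natl.
  rewrite (_ : (n + e + 1 + weight n e = n + e.+1 + weight n e)%N); last by lia.
  rewrite 2!exprD !invfM natrX mulrCA ler_piMr //.
  by rewrite ler_pdivrMr ?exprn_gt0 // mul1r -natrX ler_nat; have [] := LP e.
have mB e : measurable (B e).
  by apply: bigsetU_measurable => s _; exact: measurable_cylinder.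
apply: le_trans (measure_sigma_subadditive mu mB _ _) _.
- apply: open_measurable_cantor; apply: bigcup_open => s _.
  exact: open_cylinder.
- move=> X [_ [e [c [hist small ->]]] sX]; exists e => //.
  rewrite /B -bigcup_seq; eexists; last exact: sX.
  by apply/mapP; eexists; last reflexivity; have [_] := LP e; apply.
- apply: le_trans (@epsilon_trick0 R (2 ^- n) xpredT _); last first.
    by rewrite invr_ge0 exprn_ge0.
  by apply: lee_nneseries => [e _ _|e _]; [exact: measure_ge0|exact: muB].
Qed.

(** If the real avoids the [n]-th test, then [bound n] is a majorant, by strong induction: at a
    first step with too many zeros, the stage followed by [bound n e] of these zeros would be a test
    string on the real. *)
Lemma random_bounded h : (forall e, history h e) ->
  random_for mu r (real_of h) ->
  exists2 c, turing_le c (real_fun r) & forall e, (nfst (h e) < c e)%N.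
Proof.
move=> hist /(_ test test_sigma01 mu_test) /existsNP[n /not_implyP[_ nX]].
exists (bound n); first by apply: turing_le_bound; turing_le_auto.
move=> e; elim/ltn_ind: e => e IHe; rewrite ltnNge.
apply/negP => le_b; apply: nX.
exists (stage h e ++ nseq (bound n e) false).
  exists e, (lcode (mkseq h e)).
  have E i : (i < e)%N -> lnth (lcode (mkseq h e)) i = h i by exact: lnth_mkseq.
  rewrite (eq_history E) (eq_stage E); split=> // i ie.
  by rewrite E //; exact: IHe.
rewrite cylinderE; apply: on_prefix (on_real_of h e.+1).
apply: prefix_trans (prefix_marked _ _ _).
rewrite /marked -(subnKC le_b) nseqD -!catA catA; exact: prefix_prefix.
Qed.

End Tests.

Theorem theorem5p3 (R : realType) (d : turing_degree) :
  self_modulus_degree d -> degree_le zero_jump d ->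
  exists X : cantor_space, [/\ degree_set d X, weakly_1_generic X & NCR R X].
Proof.
move=> [A dA [f [[fA Af] modulus]]] /(_ halting_set A) zero_jump_le.
have {}zero_jump_le : turing_le (real_fun halting_set) (real_fun A).
  by apply: zero_jump_le => //; split; exact: turing_le_refl.
have [h [hA hf hist stuck]] := exists_history fA zero_jump_le.
pose X := real_of h.
have XA : turing_le (real_fun X) (real_fun A) by exact: turing_le_real_of.
have AX : turing_le (real_fun A) (real_fun X).
  apply: turing_le_trans Af _; apply: eq_turing_le (turing_le_decode hist).
  exact: hf.
exists X; split.
(* [d] is the degree of some [A0], and membership passes from [A] to the equivalent [X]. *)
- have [A0 dE] := degree_setP d; rewrite dE /= in dA *.
  exact: turing_eq_trans (conj XA AX) dA.
- by apply: real_of_weakly_1_generic => // i /stuck; rewrite hf.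
- move=> mu r cont /(representation_modulus cont)[g gr gP] Xrand.
  have [c cr fc] := random_bounded gr gP hist Xrand.
  apply: (not_random_turing_le gr gP _ Xrand).
  (* [c] exceeds [f] everywhere, so the self-modulus property applies to it. *)
  apply: turing_le_trans XA _; apply: turing_le_trans (modulus c _) cr.
  by exists 0%N => n _; rewrite -hf.
Qed.
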